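(* Let $T,B:\mathfrak H\to\mathfrak K$ be closed linear relations such that $\mathrm{mul}\,B\subseteq\ker (T_s)^*$ and $T^*B$ is selfadjoint. Let $B_0:=B\upharpoonright\mathrm{dom}(T^*B)$. Then the following statements are equivalent: (i) $T^*T\le\lambda\,T^*B$ for some $\lambda\ge0$; (ii) $X\overline{B_0}\subseteq T$ has a solution $X\in B^+(\mathfrak K)$. In this case, $X$ can be chosen such that $X\overline{B_0}\subseteq T_s$ and $\ker(T_s)^*\subseteq\ker X$ with $\|X\|\le\lambda$. Moreover, in this case $$T^*\overline{B_0}=B_0^*X\overline{B_0}=B_0^*T.$$ In particular, the following assertions are equivalent: (iii) $T^*T\le\lambda\,T^*\overline{B_0}$ for some $\lambda\ge0$, and $\mathrm{dom}\,T\subseteq\mathrm{dom}\,\overline{B_0}$; (iv) $T=X\overline{B_0}\,\dot{+}\,T_{\mathrm{mul}}$ has a solution $X\in B^+(\mathfrak K)$. In this case, $X$ can be chosen such that $T_s=X\overline{B_0}$ and $\ker X=\ker(T_s)^*$.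
   Context: $\mathfrak H,\mathfrak K$ are complex Hilbert spaces; $B^+(\mathfrak K)$ is the set of bounded everywhere defined nonnegative selfadjoint operators on $\mathfrak K$. A linear relation $T:\mathfrak H\to\mathfrak K$ is a linear subspace of $\mathfrak H\times\mathfrak K$, with the usual domain, range, kernel, multivalued part $\mathrm{mul}\,T=\{y:(0,y)\in T\}$, inverse, products and closure; operators are identified with their graphs. Its adjoint is $T^*=\{(x,x')\in\mathfrak K\times\mathfrak H:\langle x',y\rangle=\langle x,y'\rangle\text{ for all }(y,y')\in T\}$. For a closed relation $T$, the operator part is $T_s=P_sT$, where $P_s$ is the orthogonal projection onto $(\mathrm{mul}\,T)^\perp$, and $T_{\mathrm{mul}}=\{0\}\times\mathrm{mul}\,T$. For a linear subspace $D\subseteq\mathfrak H$, $B\upharpoonright D:=B\cap(D\times\mathfrak K)$. The symbol $\dot{+}$ denotes the direct sum of graphs as subspaces of $\mathfrak H\times\mathfrak K$. A relation $S$ in $\mathfrak H$ is selfadjoint if $S=S^*$, nonnegative if $\langle x',x\rangle\ge0$ for all $(x,x')\in S$; for $S=S^*\ge0$, $S_s^{1/2}$ denotes the square root of the operator part $S_s$ (selfadjoint nonnegative in $\overline{\mathrm{dom}}\,S$). For nonnegative selfadjoint relations $C,D$ and $\lambda\ge0$, $C\le\lambda D$ means $\mathrm{dom}\,D_s^{1/2}\subseteq\mathrm{dom}\,C_s^{1/2}$ and $\|C_s^{1/2}x\|\le\lambda^{1/2}\|D_s^{1/2}x\|$ for all $x\in\mathrm{dom}\,D_s^{1/2}$;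 writing such an inequality includes the assertion that $C$ and $D$ are nonnegative and selfadjoint. *)

(* Defs.v *)
From HB Require Import structures.
From mathcomp Require Import all_boot all_order all_algebra.
From mathcomp Require Import complex all_classical all_reals all_analysis.

Set Implicit Arguments.
Unset Strict Implicit.
Unset Printing Implicit Defensive.

Import Order.TTheory GRing.Theory Num.Theory.
Import numFieldNormedType.Exports.

Local Open Scope classical_set_scope.
Local Open Scope ring_scope.

HB.mixin Record CompleteNormedModule_isHilbert (R : realType) H
    of CompleteNormedModule R[i] H := {
  hdot : {dot H for @Num.conj R[i]} ;
  hdot_norm : forall x : H, `|x| ^+ 2 = hdot x x
}.

#[short(type="hilbertType")]
HB.structure Definition Hilbert (R : realType) :=
  { H of CompleteNormedModule R[i] H
       & CompleteNormedModule_isHilbert R H }.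

Local Notation "'[ x , y ]" := (hdot x y) : ring_scope.

(* The library norm of a module over R[i] takes values in R[i]. *)
Definition hnorm (R : realType) (H : hilbertType R) (x : H) : R :=
  complex.Re `|x|.

(* Relations are sets of pairs.  Products are the ones of [relation_scope]:
   [(S \; T)%relation] is the product S T, in which T acts first. *)
Section Relations.
Variable R : realType.
Implicit Types H K : hilbertType R.

Definition linear_relation H K (T : set (H * K)) : Prop :=
  submod_closed (mem T).

Definition rel_dom H K (T : set (H * K)) : set H :=
  [set x | exists y, T (x, y)].

Definition rel_ker H K (T : set (H * K)) : set H := [set x | T (x, 0)].

Definition rel_mul H K (T : set (H * K)) : set K := [set y | T (0, y)].

Definition adjoint H K (T : set (H * K)) : set (K * H) :=
  [set p | forall q, T q -> '[p.2, q.1] = '[p.1, q.2]].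

Definition rel_restr H K (T : set (H * K)) (D : set H) : set (H * K) :=
  T `&` (D `*` setT).

Definition op_graph H K (f : H -> K) : set (H * K) := [set p | p.2 = f p.1].

Definition orthocomp H (M : set H) : set H :=
  [set x | forall y, M y -> '[x, y] = 0].

(* Graph of the orthogonal projection onto M, for a closed subspace M. *)
Definition orthoproj H (M : set H) : set (H * H) :=
  [set p | M p.2 /\ orthocomp M (p.1 - p.2)].

Definition op_part H K (T : set (H * K)) : set (H * K) :=
  (orthoproj (orthocomp (rel_mul T)) \; T)%relation.

Definition mul_part H K (T : set (H * K)) : set (H * K) :=
  [set 0] `*` rel_mul T.

Definition direct_sum H K (S A B : set (H * K)) : Prop :=
  S = [set a + b | a in A & b in B] /\ A `&` B = [set 0].

Definition selfadjoint H (S : set (H * H)) : Prop := S = adjoint S.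

(* Selfadjointness in M regarded as a Hilbert space, for a closed subspace M:
   the adjoint taken in M is the part of the adjoint lying in M x M. *)
Definition selfadjoint_in H (M : set H) (S : set (H * H)) : Prop :=
  S = adjoint S `&` (M `*` M).

(* In R[i], [0 <= z] says that z is real and nonnegative. *)
Definition nonneg_rel H (S : set (H * H)) : Prop :=
  forall p, S p -> 0 <= '[p.2, p.1].

(* Q is the square root of the operator part of S = S^* >= 0, as a nonnegative
   selfadjoint operator in the closure of the domain of S. *)
Definition is_sqrt_op H (S Q : set (H * H)) : Prop :=
  [/\ rel_mul Q = [set 0],
      selfadjoint_in (closure (rel_dom S)) Q,
      nonneg_rel Q
    & (Q \; Q)%relation = op_part S].

(* Such a Q exists and is unique when S is selfadjoint and nonnegative; the
   default value set0 plays no role then. *)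
Definition sqrt_op H (S : set (H * H)) : set (H * H) :=
  xget set0 [set Q | is_sqrt_op S Q].

(* C <= lam D, including the assertion that C and D are nonnegative and
   selfadjoint. *)
Definition rel_le H (C : set (H * H)) (lam : R) (D : set (H * H)) : Prop :=
  [/\ selfadjoint C /\ nonneg_rel C,
      selfadjoint D /\ nonneg_rel D,
      rel_dom (sqrt_op D) `<=` rel_dom (sqrt_op C)
    & forall x y z, sqrt_op C (x, y) -> sqrt_op D (x, z) ->
        hnorm y <= Num.sqrt lam * hnorm z].

Definition bounded_op H K (X : {linear H -> K}) : Prop :=
  exists M : R, forall x, hnorm (X x) <= M * hnorm x.

Definition opnorm H K (X : {linear H -> K}) : R :=
  sup [set hnorm (X x) | x in [set x | hnorm x <= 1]].

(* The class B^+(K). *)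
Definition Bplus K (X : {linear K -> K}) : Prop :=
  [/\ bounded_op X, selfadjoint (op_graph X) & nonneg_rel (op_graph X)].

End Relations.

(* Main.v *)
Require Import Defs.
From HB Require Import structures.
From mathcomp Require Import all_boot all_order all_algebra.
From mathcomp Require Import complex all_classical all_reals all_analysis.
From mathcomp Require Import ring lra.

Set Implicit Arguments.
Unset Strict Implicit.
Unset Printing Implicit Defensive.

(** Put [A = T^* B], selfadjoint, let [B0] be the part of [B] over [dom A], and
    write [T_s] for the operator part of [T].  The proof compares two quadratic
    forms.

    If [A] is nonnegative, then [A = Q^* Q] with [Q] its square root, and the
    square root of [T^* T] has the domain and the norms of [T_s].  Hence
    [T^* T <= lam A] says that [dom Q] lies in [dom T] and that
    [|T_s x| <= sqrt lam * |Q x|] there ([rel_leP]).  Then [Q x |-> T_s x]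
    extends to a bounded operator [J] of norm at most [sqrt lam] that vanishes
    on the orthocomplement of [ran Q].

    From (i) to (ii), take [X = J J^*].  If [(x, y)] is in [B0] and [(x, z)] in
    [A], then [<y, T_s u> = <z, u> = <Q x, Q u>] for all [u] in [dom Q]; this is
    where [mul B <= ker (T_s)^*] enters, since [y] need not itself be in
    [dom T^*].  So [J^* y - Q x] is orthogonal to [ran Q], whence
    [X y = J (Q x) = T_s x].  As [T_s] is closed and [X] bounded this passes to
    the closure of [B0] ([solution_of_form_le]).

    From (ii) to (i), [<z, x> = <y, X y>] for [(x, y)] in [B0] and [(y, z)] in
    [T^*], and this dominates [|X y|^2 / c] when [X] is nonnegative with bound [c].
    This is the wanted inequality over [dom A], which is a core of [Q], so
    it extends to [dom Q] ([form_le_of_core], [form_le_of_solution]).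

    For the product identities, the inclusions
    [A = T^* B0 <= T^* cl(B0) <= B0^* X cl(B0) <= B0^* T <= (T^* B0)^* = A]
    close up because [A] is selfadjoint ([solution_comp_eq]).

    For (iii) and (iv), [T^* cl(B0)] is a selfadjoint extension of the
    selfadjoint [A], so it equals [A] and (iii) contains (i).  The operator
    [X cl(B0)] is then a restriction of [T_s] with at least the same domain, that
    is [T_s] itself, and [T] is the direct sum of [T_s] and its multivalued part.

    The Hilbert space theory underneath starts from the orthogonal projection
    of a pair [(h, k)] onto a closed relation ([graph_projection]).  It yields
    the extension and the adjoint of bounded operators, the selfadjointness of
    [T^* T], and the core property.  The square root of an unbounded [S >= 0] is
    assembled from those of the bounded operators [(1 + S)^-1] and
    [1 - (1 + S)^-1] ([sqrt_op_ex]). *)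

Import Order.TTheory GRing.Theory Num.Theory.
Import numFieldNormedType.Exports.

Local Open Scope classical_set_scope.
Local Open Scope ring_scope.

Local Notation "'[ x , y ]" := (hdot x y) : ring_scope.

(** * The real inner product *)

(** Orthogonality to a complex subspace can be tested on real parts, by applying
    the test to the multiples by [i] as well ([dotE]).  Working with the real
    inner product makes every scalar identity a matter for [ring] and [lra]. *)
Definition rdot (R : realType) (H : hilbertType R) (x y : H) : R :=
  complex.Re '[x, y].

Section InnerProduct.
Variables (R : realType) (H : hilbertType R).
Implicit Types (x y z : H) (a b : R).

Lemma dotDl x y z : '[x + y, z] = '[x, z] + '[y, z]. Proof. exact: linearDl. Qed.
Lemma dotZl (c : R[i]) x y : '[c *: x, y] = c * '[x, y]. Proof. exact: linearZl_LR. Qed.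
Lemma dotZr (c : R[i]) x y : '[x, c *: y] = (c^*)%C * '[x, y].
Proof. by rewrite linearZr_LR. Qed.
Lemma dotC x y : '[x, y] = ('[y, x]^*)%C.
Proof. by rewrite hermC expr0 mul1r. Qed.

Lemma rdotDl x y z : rdot (x + y) z = rdot x z + rdot y z.
Proof. by rewrite /rdot dotDl; case: '[x, z] => ? ?; case: '[y, z]. Qed.
Lemma rdotC x y : rdot x y = rdot y x.
Proof. by rewrite /rdot dotC; case: '[y, x]. Qed.
Lemma rdotDr x y z : rdot z (x + y) = rdot z x + rdot z y.
Proof. by rewrite rdotC rdotDl !(rdotC z). Qed.
Lemma rdotZl a x y : rdot (a%:C *: x)%C y = a * rdot x y.
Proof. by rewrite /rdot dotZl; case: '[x, y] => u v /=; ring. Qed.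
Lemma rdotZr a x y : rdot x (a%:C *: y)%C = a * rdot x y.
Proof. by rewrite rdotC rdotZl rdotC. Qed.
Lemma rdot0l x : rdot 0 x = 0. Proof. by rewrite /rdot linear0l. Qed.
Lemma rdotNl x y : rdot (- x) y = - rdot x y.
Proof. by apply/eqP; rewrite -addr_eq0 -rdotDl addNr rdot0l. Qed.
Lemma rdotNr x y : rdot x (- y) = - rdot x y.
Proof. by rewrite rdotC rdotNl rdotC. Qed.
Lemma rdotBl x y z : rdot (x - y) z = rdot x z - rdot y z.
Proof. by rewrite rdotDl rdotNl. Qed.
Lemma rdotBr x y z : rdot z (x - y) = rdot z x - rdot z y.
Proof. by rewrite rdotDr rdotNr. Qed.
Lemma rdot0r x : rdot x 0 = 0. Proof. by rewrite rdotC rdot0l. Qed.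

Definition rdotE := (rdotDl, rdotDr, rdotBl, rdotBr, rdotZl, rdotZr, rdotNl,
  rdotNr, rdot0l, rdot0r).

Lemma dotE x y : '[x, y] = (rdot x y +i* rdot x ('i%C *: y))%C.
Proof. by rewrite /rdot dotZr; case: '[x, y] => u v /=; congr (_ +i* _)%C; ring. Qed.

Lemma normE x : `|x| = ((hnorm x)%:C)%C.
Proof. by rewrite /hnorm RRe_real // normr_real. Qed.

Lemma hnorm_ge0 x : 0 <= hnorm x.
Proof. by have := normr_ge0 x; rewrite normE ler0c. Qed.

Lemma rdotxx x : rdot x x = hnorm x ^+ 2.
Proof. by rewrite /rdot -hdot_norm normE -rmorphXn. Qed.

Lemma hnorm0 : hnorm (0 : H) = 0. Proof. by rewrite /hnorm normr0. Qed.

Lemma hnorm_eq0 x : hnorm x = 0 -> x = 0.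
Proof. by move=> x0; apply/normr0_eq0; rewrite normE x0. Qed.

Lemma rdotxx_ge0 x : 0 <= rdot x x. Proof. by rewrite rdotxx sqr_ge0. Qed.

Lemma rdotxx_eq0 x : rdot x x <= 0 -> x = 0.
Proof.
rewrite rdotxx => x0; apply: hnorm_eq0; apply/eqP.
by rewrite -sqrf_eq0 -(rwP eqP); apply/le_anti; rewrite x0 sqr_ge0.
Qed.

(** Turns an identity between vectors into a scalar one that [ring] decides
    after expansion by [rdotE]. *)
Lemma rdot_inj x y : (forall z, rdot x z = rdot y z) -> x = y.
Proof.
move=> xy; apply/eqP; rewrite -subr_eq0; apply/eqP/rdotxx_eq0.
by rewrite rdotBl xy subrr.
Qed.

Lemma hnorm_opp x : hnorm (- x) = hnorm x. Proof. by rewrite /hnorm normrN. Qed.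
Lemma hdistC x y : hnorm (x - y) = hnorm (y - x).
Proof. by rewrite /hnorm distrC. Qed.
Lemma ler_hnormD x y : hnorm (x + y) <= hnorm x + hnorm y.
Proof. by have := ler_normD x y; rewrite !normE -rmorphD lecR. Qed.
Lemma hnorm_trans z x y : hnorm (x - y) <= hnorm (x - z) + hnorm (z - y).
Proof. by rewrite (le_trans _ (ler_hnormD _ _)) // addrA subrK. Qed.
Lemma hnormZc (c : R[i]) x : hnorm (c *: x) = complex.Re `|c| * hnorm x.
Proof.
by apply: complexI; rewrite -normE normrZ normE rmorphM /=; congr (_ * _).
Qed.
Lemma hnormZ a x : hnorm (a%:C *: x)%C = `|a| * hnorm x.
Proof. by rewrite hnormZc normc_def /= expr0n addr0 sqrtr_sqr. Qed.

Lemma ler_hnormP x (c : R) : 0 <= c -> (hnorm x <= c) = (rdot x x <= c ^+ 2).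
Proof. by move=> c0; rewrite rdotxx ler_sqr ?nnegrE// hnorm_ge0. Qed.

Lemma cauchy_schwarz x y : rdot x y <= hnorm x * hnorm y.
Proof.
have := rdotxx_ge0 ((hnorm y)%:C *: x - (hnorm x)%:C *: y)%C.
rewrite !rdotE (rdotC y x) !rdotxx.
have := hnorm_ge0 x; have := hnorm_ge0 y.
case: (eqVneq (hnorm x) 0) => [/hnorm_eq0 ->|x0]; first by rewrite rdot0l hnorm0; lra.
case: (eqVneq (hnorm y) 0) => [/hnorm_eq0 ->|y0]; first by rewrite rdot0r hnorm0; lra.
move=> y1 x1 h.
have {}x1 : 0 < hnorm x by rewrite lt_neqAle eq_sym x0.
have {}y1 : 0 < hnorm y by rewrite lt_neqAle eq_sym y0.
have xy : 0 < hnorm x * hnorm y by exact: mulr_gt0.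
rewrite -(ler_pM2l xy); lra.
Qed.

Lemma cauchy_schwarz_abs x y : `|rdot x y| <= hnorm x * hnorm y.
Proof.
by rewrite ler_norml cauchy_schwarz lerNl -rdotNl -(hnorm_opp x) cauchy_schwarz.
Qed.

End InnerProduct.

Lemma ler_hnorm2 (R : realType) (H K : hilbertType R) (x : H) (y : K) :
  (hnorm x <= hnorm y) = (rdot x x <= rdot y y).
Proof. by rewrite ler_hnormP ?hnorm_ge0// -rdotxx. Qed.

(** * Closure and completeness *)

Section Limits.
Variables (R : realType).
Implicit Types (H K : hilbertType R).

Lemma nbhs_hnorm H (x : H) (B : set H) :
  nbhs x B <-> exists2 e : R, 0 < e & forall y, hnorm (x - y) < e -> B y.
Proof.
split=> [/nbhs_normP[e /= e0 eB]|[e e0 eB]].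
  move: e0; rewrite ltcE /= => /andP[/eqP ie e0].
  exists (complex.Re e) => // y xy; apply: eB => /=.
  by rewrite normE ltcE /= -ie eqxx.
apply/nbhs_normP; exists (e%:C)%C; rewrite /= ?ltcR// => y /=.
by rewrite normE ltcR; exact: eB.
Qed.

Lemma closureP H (A : set H) x :
  closure A x <-> forall e : R, 0 < e -> exists2 y, A y & hnorm (x - y) < e.
Proof.
split=> [cA e e0|cA B /nbhs_hnorm[e e0 eB]].
  have /cA[y [Ay xy]] : nbhs x [set y | hnorm (x - y) < e].
    by apply/nbhs_hnorm; exists e.
  by exists y.
by have [y Ay xy] := cA e e0; exists y; split=> //; exact: eB.
Qed.

Lemma closure2P H K (A : set (H * K)) x y :
  closure A (x, y) <-> forall e : R, 0 < e ->
    exists u v, [/\ A (u, v), hnorm (x - u) < e & hnorm (y - v) < e].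
Proof.
split=> [cA e e0|cA B [[B1 B2] /= [/nbhs_hnorm[e e0 eB] /nbhs_hnorm[f f0 fB]] sB]].
  have /cA[[u v] [Ay [xu yv]]] :
      nbhs (x, y) ([set u | hnorm (x - u) < e] `*` [set v | hnorm (y - v) < e]).
    by exists ([set u | hnorm (x - u) < e], [set v | hnorm (y - v) < e]) => //=;
      split; apply/nbhs_hnorm; exists e.
  by exists u, v.
have ef0 : 0 < Num.min e f by rewrite lt_min e0 f0.
have [u [v [Auv]]] := cA _ ef0; rewrite !lt_min => /andP[xe _] /andP[_ yf].
by exists (u, v); split=> //; apply: sB; split=> /=; [apply: eB|apply: fB].
Qed.

(** Completeness for a shrinking family of sets of small diameter: approximants
    then need not be chosen as a sequence. *)
Lemma cauchy_family H (P : R -> set H) :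
    (forall e, 0 < e -> P e !=set0) ->
    (forall e f, 0 < e -> e <= f -> P e `<=` P f) ->
    (forall e x y, 0 < e -> P e x -> P e y -> hnorm (x - y) <= e) ->
  exists l, forall e x, 0 < e -> P e x -> hnorm (x - l) <= e.
Proof.
move=> ne mono diam.
pose F := filter_from [set e : R | 0 < e] P.
have FF : ProperFilter F.
  apply: filter_from_proper => //; apply: filter_from_filter; first by exists 1 => /=.
  move=> e f /= e0 f0; exists (Num.min e f); first by rewrite /= lt_min e0 f0.
  have ef0 : 0 < Num.min e f by rewrite lt_min e0 f0.
  by move=> x Px; split; apply: mono Px; rewrite // ge_min lexx ?orbT.
have /cauchy_cvg : cauchy F.
  apply: cauchy_exP => e e0.
  move: (e0); rewrite ltcE /= => /andP[/eqP ie re0].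
  have he : 0 < complex.Re e / 2 by rewrite divr_gt0.
  have [x Px] := ne _ he; exists x; exists (complex.Re e / 2) => // y Py.
  rewrite -ball_normE /= normE ltcE /= -ie eqxx /=.
  by rewrite (le_lt_trans (diam _ _ _ he Px Py)) // ltr_pdivrMr// mulr_natr mulr2n ltrDl.
move=> /cvgP; set l := lim F => Fl; exists l => e x e0 Px.
apply/ler_addgt0Pr => d d0.
have : nbhs l [set y | hnorm (l - y) < d] by apply/nbhs_hnorm; exists d.
move=> /Fl [f /= f0 fd].
have ef0 : 0 < Num.min e f by rewrite lt_min e0 f0.
have [y Py] := ne _ ef0.
have Pey : P e y by apply: mono Py => //; rewrite ge_min lexx.
have /fd/= ly : P f y by apply: mono Py => //; rewrite ge_min lexx orbT.
apply: (le_trans (hnorm_trans y _ _)); apply: lerD; first exact: diam Px Pey.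
by rewrite hdistC ltW.
Qed.

End Limits.

(** Limit passages below take this form: an estimate whose error is linear in a
    free parameter [e]. *)
Lemma le0_of_small (R : realType) (r C : R) :
  (forall e, 0 < e -> e <= 1 -> r <= e * C) -> r <= 0.
Proof.
move=> h; rewrite leNgt; apply/negP => r0.
have C0 : 0 < C by have := h 1 ltr01 (lexx _); rewrite mul1r; exact: lt_le_trans.
have e0 : 0 < Num.min 1 (r / (2 * C)) by rewrite lt_min ltr01 divr_gt0 ?mulr_gt0.
have e1 : Num.min 1 (r / (2 * C)) <= 1 by rewrite ge_min lexx.
have := h _ e0 e1; apply/negP; rewrite -ltNge.
apply: (@le_lt_trans _ _ (r / (2 * C) * C)).
  by rewrite ler_pM2r // ge_min lexx orbT.
have -> : r / (2 * C) * C = r / 2 by field; rewrite gt_eqF.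
lra.
Qed.

(** * Subspaces, closed relations and projections *)

Definition linear_subset (R : realType) (H : hilbertType R) (M : set H) : Prop :=
  submod_closed (mem M).

Section Subspaces.
Variables (R : realType).
Implicit Types (H K L : hilbertType R).

Lemma linear_subset0 H (M : set H) : linear_subset M -> M 0.
Proof. by case=> + _; rewrite inE. Qed.
Lemma linear_subsetP H (M : set H) c x y :
  linear_subset M -> M x -> M y -> M (c *: x + y).
Proof. by case=> _ h Mx My; have := h c x y; rewrite !inE; apply. Qed.
Lemma linear_subsetZ H (M : set H) c x : linear_subset M -> M x -> M (c *: x).
Proof.
by move=> lM Mx; rewrite -[_ *: _]addr0; exact: linear_subsetP lM Mx (linear_subset0 lM).
Qed.
Lemma linear_subsetD H (M : set H) x y :
  linear_subset M -> M x -> M y -> M (x + y).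
Proof. by move=> lM Mx My; rewrite -[x]scale1r; exact: linear_subsetP. Qed.
Lemma linear_subsetB H (M : set H) x y :
  linear_subset M -> M x -> M y -> M (x - y).
Proof. by move=> lM Mx My; rewrite addrC -scaleN1r; exact: linear_subsetP. Qed.
Lemma linear_subsetI H (M : set H) :
  M 0 -> (forall c x y, M x -> M y -> M (c *: x + y)) -> linear_subset M.
Proof. by move=> M0 MP; split=> [|c x y]; rewrite !inE //; exact: MP. Qed.

Lemma linear_relation0 H K (T : set (H * K)) : linear_relation T -> T (0, 0).
Proof. by case=> + _; rewrite inE. Qed.
Lemma linear_relationP H K (T : set (H * K)) c x y u v :
  linear_relation T -> T (x, y) -> T (u, v) -> T (c *: x + u, c *: y + v).
Proof. by case=> _ h Mx My; have := h c (x, y) (u, v); rewrite !inE; apply. Qed.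
Lemma linear_relationZ H K (T : set (H * K)) c x y :
  linear_relation T -> T (x, y) -> T (c *: x, c *: y).
Proof.
move=> lT Tx; rewrite -[c *: x]addr0 -[c *: y]addr0.
exact: linear_relationP lT Tx (linear_relation0 lT).
Qed.
Lemma linear_relationD H K (T : set (H * K)) x y u v :
  linear_relation T -> T (x, y) -> T (u, v) -> T (x + u, y + v).
Proof. by move=> lT Tx Tu; rewrite -[x]scale1r -[y]scale1r; exact: linear_relationP. Qed.
Lemma linear_relationB H K (T : set (H * K)) x y u v :
  linear_relation T -> T (x, y) -> T (u, v) -> T (x - u, y - v).
Proof.
move=> lT Tx Tu; rewrite (addrC x) (addrC y) -(scaleN1r u) -(scaleN1r v).
exact: linear_relationP.
Qed.
Lemma linear_relationI H K (T : set (H * K)) :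
    T (0, 0) ->
    (forall c x y u v, T (x, y) -> T (u, v) -> T (c *: x + u, c *: y + v)) ->
  linear_relation T.
Proof. by move=> T0 TP; split=> [|c [x y] [u v]]; rewrite !inE //; exact: TP. Qed.

Lemma linear_rel_dom H K (T : set (H * K)) :
  linear_relation T -> linear_subset (rel_dom T).
Proof.
move=> lT; apply: linear_subsetI; first by exists 0; exact: linear_relation0.
by move=> c x y [u Tu] [v Tv]; exists (c *: u + v); exact: linear_relationP.
Qed.

Lemma linear_rel_mul H K (T : set (H * K)) :
  linear_relation T -> linear_subset (rel_mul T).
Proof.
move=> lT; apply: linear_subsetI; first exact: linear_relation0.
move=> c x y /= Tx Ty; have := linear_relationP c lT Tx Ty.
by rewrite scaler0 addr0.
Qed.

Lemma linear_comp H K L (S : set (K * L)) (T : set (H * K)) :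
  linear_relation S -> linear_relation T -> linear_relation (S \; T)%relation.
Proof.
move=> lS lT; apply: linear_relationI.
  by exists 0; exact: linear_relation0.
move=> c x y u v [z Tz Sz] [w Tw Sw]; exists (c *: z + w) => /=;
  exact: linear_relationP.
Qed.

Lemma linear_closure H K (T : set (H * K)) :
  linear_relation T -> linear_relation (closure T).
Proof.
move=> lT; apply: linear_relationI; first by apply: subset_closure; exact: linear_relation0.
move=> c x y u v /closure2P cx /closure2P cu; apply/closure2P => e e0.
set a := complex.Re `|c|.
have a0 : 0 <= a by have := normr_ge0 c; rewrite lecE => /andP[].
have d0 : 0 < e / (a + 1) by rewrite divr_gt0 // ltr_wpDl.
have dE : a * (e / (a + 1)) + e / (a + 1) = e by field; rewrite gt_eqF// ltr_wpDl.
have [x' [y' [Tx xx' yy']]] := cx _ d0; have [u' [v' [Tu uu' vv']]] := cu _ d0.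
exists (c *: x' + u'), (c *: y' + v'); split; first exact: linear_relationP.
- rewrite opprD addrACA -scalerBr (le_lt_trans (ler_hnormD _ _))// -dE hnormZc.
  by rewrite ler_ltD // ler_wpM2l // ltW.
- rewrite opprD addrACA -scalerBr (le_lt_trans (ler_hnormD _ _))// -dE hnormZc.
  by rewrite ler_ltD // ler_wpM2l // ltW.
Qed.

(** Continuity of the inner product in the one form that is used: a linear
    equation satisfied on [A] persists on its closure. *)
Lemma closure_orth2 H K (A : set (H * K)) u v x y :
    (forall a b, A (a, b) -> rdot a u + rdot b v = 0) ->
  closure A (x, y) -> rdot x u + rdot y v = 0.
Proof.
move=> Auv /closure2P cA; apply/eqP; rewrite -normr_eq0 eq_le normr_ge0 andbT.
apply: (@le0_of_small _ _ (hnorm u + hnorm v)) => e e0 _.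
have [a [b [Aab xa yb]]] := cA _ e0.
have -> : rdot x u + rdot y v = rdot (x - a) u + rdot (y - b) v.
  by rewrite !rdotE; have := Auv _ _ Aab; lra.
rewrite (le_trans (ler_normD _ _))// mulrDr lerD //.
  by rewrite (le_trans (cauchy_schwarz_abs _ _))// ler_wpM2r ?hnorm_ge0 ?ltW.
by rewrite (le_trans (cauchy_schwarz_abs _ _))// ler_wpM2r ?hnorm_ge0 ?ltW.
Qed.

Lemma closure_setX0 H (M : set H) x (y : H) :
  closure (M `*` [set (0 : H)]) (x, y) -> closure M x /\ y = 0.
Proof.
move=> /closure2P cA; split.
  by apply/closureP => e /cA [a [b [[/= Ma _] xa _]]]; exists a.
apply/hnorm_eq0/eqP; rewrite eq_le hnorm_ge0 andbT.
apply: (@le0_of_small _ _ 1) => e e0 _; rewrite mulr1.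
by have [a [b [[_ /= ->] _]]] := cA _ e0; rewrite subr0; exact: ltW.
Qed.

Lemma closure_orth H (A : set H) u x :
  (forall a, A a -> rdot a u = 0) -> closure A x -> rdot x u = 0.
Proof.
move=> Au /closureP cA.
rewrite -[LHS]addr0 -[X in _ + X](rdot0l (0 : H)).
apply: (@closure_orth2 H H (A `*` [set (0 : H)])).
  by move=> a b [/= /Au -> ->]; rewrite rdot0l addr0.
apply/closure2P => e e0; have [y Ay xy] := cA _ e0.
by exists y, 0; split=> //; rewrite subr0 hnorm0.
Qed.

Lemma closure_bound H K (A : set (H * K)) (c : R) x y : 0 <= c ->
    (forall a b, A (a, b) -> hnorm b <= c * hnorm a) ->
  closure A (x, y) -> hnorm y <= c * hnorm x.
Proof.
move=> c0 Ac /closure2P cA; rewrite -subr_le0.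
apply: (@le0_of_small _ _ (c + 1)) => e e0 _.
have [a [b [Aab xa yb]]] := cA _ e0.
have := Ac _ _ Aab.
have := hnorm_trans b y 0; have := hnorm_trans x a 0; rewrite !subr0 hdistC => h1 h2 h3.
have : c * hnorm a <= c * (e + hnorm x).
  by rewrite ler_wpM2l// (le_trans h1)// lerD2r ltW.
move: h3 h2 yb; lra.
Qed.

Lemma linear_setX0 H (M : set H) :
  linear_subset M -> linear_relation (M `*` [set (0 : H)]).
Proof.
move=> lM; apply: linear_relationI; first by split=> //; exact: linear_subset0.
move=> c x y u v [/= Mx ->] [/= Mu ->]; split; last by rewrite /= scaler0 addr0.
exact: linear_subsetP.
Qed.

(** The projection theorem for the Hilbert norm of [H * K], which is equivalent to
    its maximum norm and so has the same closed subspaces: a minimizing family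
    for the squared distance is Cauchy by the parallelogram law, and a first
    variation gives orthogonality at the limit. *)
Lemma graph_projection H K (T : set (H * K)) h k :
    linear_relation T -> closed T ->
  exists x y, T (x, y) /\
    forall u v, T (u, v) -> rdot (h - x) u + rdot (k - y) v = 0.
Proof.
move=> lT clT.
pose f (p : H * K) := rdot (h - p.1) (h - p.1) + rdot (k - p.2) (k - p.2).
have f0 p : 0 <= f p by rewrite addr_ge0 ?rdotxx_ge0.
pose E := [set f p | p in T]; pose d := inf E.
have hE : has_inf E.
  split; first by exists (f (0, 0)), (0, 0) => //; exact: linear_relation0.
  by exists 0 => _ [p _ <-].
have dle p : T p -> d <= f p.
  by move=> Tp; apply: ge_inf; [case: hE|exists p].
pose P (e : R) := [set p | T p /\ f p <= d + (e / 2) ^+ 2].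
have Pne e : 0 < e -> P e !=set0.
  move=> e0; have e2 : 0 < (e / 2) ^+ 2 by rewrite exprn_gt0 // divr_gt0.
  have [_ [p Tp <-] pd] := inf_adherent e2 hE.
  by exists p; split=> //; exact: ltW.
have Pmono e g : 0 < e -> e <= g -> P e `<=` P g.
  move=> e0 eg p [Tp fp]; split=> //; rewrite (le_trans fp)// lerD2l.
  by rewrite ler_sqr ?nnegrE; lra.
have Pdiam e p q : 0 < e -> P e p -> P e q ->
    rdot (p.1 - q.1) (p.1 - q.1) + rdot (p.2 - q.2) (p.2 - q.2) <= e ^+ 2.
  move=> e0 [Tp fp] [Tq fq].
  have /dle : T (((2^-1)%:C *: (p.1 + q.1), (2^-1)%:C *: (p.2 + q.2)))%C.
    apply: linear_relationZ => //; apply: linear_relationD => //.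
      by rewrite -surjective_pairing.
    by rewrite -surjective_pairing.
  move: fp fq; rewrite /f /= !rdotE.
  rewrite !(rdotC _ h) !(rdotC _ k) (rdotC q.1 p.1) (rdotC q.2 p.2); lra.
have [l1 Pl1] : exists l1, forall e x, 0 < e -> [set p.1 | p in P e] x -> hnorm (x - l1) <= e.
  apply: cauchy_family => [e e0|e g e0 eg _ [p Pp <-]|e _ _ e0 [p Pp <-] [q Pq <-]].
  - by have [p Pp] := Pne _ e0; exists p.1, p.
  - by exists p => //; exact: Pmono Pp.
  - rewrite (ler_hnormP _ (ltW e0)); have := Pdiam _ _ _ e0 Pp Pq.
    by have := rdotxx_ge0 (p.2 - q.2); lra.
have [l2 Pl2] : exists l2, forall e x, 0 < e -> [set p.2 | p in P e] x -> hnorm (x - l2) <= e.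
  apply: cauchy_family => [e e0|e g e0 eg _ [p Pp <-]|e _ _ e0 [p Pp <-] [q Pq <-]].
  - by have [p Pp] := Pne _ e0; exists p.2, p.
  - by exists p => //; exact: Pmono Pp.
  - rewrite (ler_hnormP _ (ltW e0)); have := Pdiam _ _ _ e0 Pp Pq.
    by have := rdotxx_ge0 (p.1 - q.1); lra.
have Tl : T (l1, l2).
  apply: clT; apply/closure2P => e e0; have e2 : 0 < e / 2 by rewrite divr_gt0.
  have [[x y] Pp] := Pne _ e2; exists x, y; split; first by case: Pp.
    rewrite hdistC (le_lt_trans (Pl1 _ _ e2 _))//; last by lra.
    by exists (x, y).
  rewrite hdistC (le_lt_trans (Pl2 _ _ e2 _))//; last by lra.
  by exists (x, y).
exists l1, l2; split=> // u v Tuv.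
pose B x y := rdot (h - x) u + rdot (k - y) v.
pose W := rdot u u + rdot v v.
have W0 : 0 <= W by rewrite addr_ge0 ?rdotxx_ge0.
(* First variation: moving from a near-minimizer by [t * (u, v)] cannot gain
   more than its defect; the defect then tends to zero. *)
have key t : 2 * t * B l1 l2 - t ^+ 2 * W <= 0.
  apply: (@le0_of_small _ _ (1 + 2 * `|t| * (hnorm u + hnorm v))) => e e0 e1.
  have [[x y] [Txy fxy]] := Pne _ e0.
  have /dle : T (x + t%:C%C *: u, y + t%:C%C *: v).
    by apply: linear_relationD => //; exact: linear_relationZ.
  have xl : hnorm (x - l1) <= e by apply: Pl1 => //; exists (x, y).
  have yl : hnorm (y - l2) <= e by apply: Pl2 => //; exists (x, y).
  have h1 : t * (rdot (x - l1) u + rdot (y - l2) v) <= `|t| * (e * (hnorm u + hnorm v)).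
    rewrite (le_trans (ler_norm _))// normrM ler_wpM2l//.
    rewrite (le_trans (ler_normD _ _))// mulrDr lerD //.
      by rewrite (le_trans (cauchy_schwarz_abs _ _))// ler_wpM2r ?hnorm_ge0.
    by rewrite (le_trans (cauchy_schwarz_abs _ _))// ler_wpM2r ?hnorm_ge0.
  have h2 : (e / 2) ^+ 2 <= e.
    have : e * e <= e * 1 by rewrite ler_pM2l.
    by rewrite expr2; lra.
  move: fxy; rewrite /f /B /W /= !rdotE.
  rewrite !(rdotC _ h) !(rdotC _ k) (rdotC u x) (rdotC v y).
  move: h1 h2; rewrite !rdotE.
  lra.
rewrite -/(B l1 l2).
(* The optimal step is [B / W]; the denominator [W + 1] also covers [W = 0]. *)
have := key (B l1 l2 / (W + 1)).
have W1 : 0 < W + 1 by rewrite ltr_wpDl.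
have -> : 2 * (B l1 l2 / (W + 1)) * B l1 l2 - (B l1 l2 / (W + 1)) ^+ 2 * W
  = (B l1 l2 / (W + 1)) ^+ 2 * (W + 2) by field; rewrite gt_eqF.
rewrite pmulr_lle0; last by lra.
move=> h0; have : (B l1 l2 / (W + 1)) ^+ 2 == 0 by rewrite eq_le h0 sqr_ge0.
by rewrite sqrf_eq0 mulf_eq0 invr_eq0 (gt_eqF W1) orbF => /eqP.
Qed.

(** The case of the relation [M * {0}]. *)
Lemma subspace_projection H (M : set H) x :
    linear_subset M -> exists m, closure M m /\ forall u, M u -> rdot (x - m) u = 0.
Proof.
move=> lM.
have [m [y [+ Pm]]] := graph_projection x 0 (linear_closure (linear_setX0 lM))
  (@closed_closure _ _).
move=> /closure_setX0[cm _].
exists m; split=> // u Mu; rewrite -[LHS]addr0 -[X in _ + X](rdot0r (0 - y)).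
by apply: Pm; apply: subset_closure.
Qed.

End Subspaces.

(** * Adjoints and bounded operators *)

Section Adjoint.
Variables (R : realType).
Implicit Types (H K L : hilbertType R).

Lemma adjoint_rdot H K (T : set (H * K)) k h x y :
  adjoint T (k, h) -> T (x, y) -> rdot h x = rdot k y.
Proof. by move=> Tkh Txy; congr complex.Re; exact: (Tkh (x, y)). Qed.

Lemma adjointP H K (T : set (H * K)) k h : linear_relation T ->
  adjoint T (k, h) <-> forall x y, T (x, y) -> rdot h x = rdot k y.
Proof.
move=> lT; split=> [Tkh x y|Tkh [x y] Txy /=]; first exact: adjoint_rdot.
rewrite 2!dotE (Tkh _ _ Txy); congr (_ +i* _)%C.
by apply: Tkh; exact: linear_relationZ.
Qed.

Lemma linear_adjoint H K (T : set (H * K)) : linear_relation (adjoint T).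
Proof.
apply: linear_relationI => [[x y] _ /=|c x y u v Txy Tuv [a b] Tab /=].
  by rewrite !linear0l.
by rewrite !dotDl !dotZl (Txy (a, b) Tab) (Tuv (a, b) Tab).
Qed.

Lemma closed_adjoint H K (T : set (H * K)) :
  linear_relation T -> closed (adjoint T).
Proof.
move=> lT [k h] cT; apply/adjointP => // x y Txy.
apply/eqP; rewrite -subr_eq0 addrC -rdotNr; apply/eqP.
apply: closure_orth2 cT => a b Tab.
by rewrite rdotNr (adjoint_rdot Tab Txy) addNr.
Qed.

Lemma adjointS H K (S T : set (H * K)) : S `<=` T -> adjoint T `<=` adjoint S.
Proof. by move=> ST p Tp q Sq; apply: Tp; exact: ST. Qed.

Lemma adjoint_closure H K (T : set (H * K)) :
  linear_relation T -> adjoint (closure T) = adjoint T.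
Proof.
move=> lT; apply/seteqP; split=> [|[k h] Tkh]; first exact: adjointS (@subset_closure _ _).
apply/adjointP; first exact: linear_closure.
move=> x y cT; apply/eqP; rewrite -subr_eq0 (rdotC h) (rdotC k) -rdotNr.
apply/eqP; apply: closure_orth2 cT => a b Tab.
by rewrite rdotNr (rdotC a) (rdotC b) (adjoint_rdot Tkh Tab) subrr.
Qed.

(** The orthocomplement of a graph is the adjoint graph up to the rotation
    [(v, u) |-> (- u, v)]. *)
Lemma graph_decomposition H K (T : set (H * K)) h k :
    linear_relation T -> closed T ->
  exists x y u v, [/\ T (x, y), adjoint T (v, u), h = x - u & k = y + v].
Proof.
move=> lT clT; have [x [y [Txy Pxy]]] := graph_projection h k lT clT.
exists x, y, (x - h), (k - y); split=> //; last 2 first.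
- by rewrite opprB addrC subrK.
- by rewrite addrC subrK.
apply/adjointP => // u v Tuv; have := Pxy _ _ Tuv; rewrite !rdotE; lra.
Qed.

Lemma orthocomp_rdot H (M : set H) x y : orthocomp M x -> M y -> rdot x y = 0.
Proof. by move=> Mx My; rewrite /rdot Mx. Qed.

Lemma orthocompP H (M : set H) x : linear_subset M ->
  orthocomp M x <-> forall y, M y -> rdot x y = 0.
Proof.
move=> lM; split=> [Mx y|Mx y My]; first exact: orthocomp_rdot.
by rewrite dotE Mx // Mx //; exact: linear_subsetZ.
Qed.

Lemma linear_orthocomp H (M : set H) : linear_subset (orthocomp M).
Proof.
apply: linear_subsetI => [y _|c x y Mx My z Mz]; first by rewrite linear0l.
by rewrite dotDl dotZl Mx // My // mulr0 addr0.
Qed.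

Lemma closed_orthocomp H (M : set H) : linear_subset M -> closed (orthocomp M).
Proof.
move=> lM x cx; apply/orthocompP => // y My.
by apply: closure_orth cx => a Ma; exact: orthocomp_rdot Ma My.
Qed.

Lemma linear_fun_ex H K (f : H -> K) :
    (forall c x y, f (c *: x + y) = c *: f x + f y) ->
  exists F : {linear H -> K}, forall x, F x = f x.
Proof.
move=> lf; have lf' : linear f by move=> c x y; exact: lf.
pose F : {linear H -> K} :=
  HB.pack_for {linear H -> K} f (GRing.isLinear.Build _ _ _ _ f lf').
by exists F.
Qed.

(** If [u] in [dom N] tends to [p], boundedness makes the values over such [u] a
    Cauchy family, so the domain of the closure of [N] is closed. *)
Lemma bounded_closure_total H K (N : set (H * K)) (c : R) p :
    linear_relation N -> 0 <= c ->
    (forall h k, N (h, k) -> hnorm k <= c * hnorm h) ->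
  closure (rel_dom N) p -> exists k, closure N (p, k).
Proof.
move=> lN c0 Nc /closureP cp.
have c1 : 0 < 2 * (c + 1) by rewrite mulr_gt0 // ltr_wpDl.
pose P (e : R) := [set k | exists u, N (u, k) /\ hnorm (p - u) <= e / (2 * (c + 1))].
have Pne e : 0 < e -> P e !=set0.
  move=> e0; have /cp[u [k Nuk] pu] : 0 < e / (2 * (c + 1)) by rewrite divr_gt0.
  by exists k, u; split=> //; exact: ltW.
have [k Pk] : exists k, forall e x, 0 < e -> P e x -> hnorm (x - k) <= e.
  apply: cauchy_family => // [e g e0 eg k [u [Nu pu]]|e k k' e0 [u [Nu pu]] [u' [Nu' pu']]].
    by exists u; split=> //; rewrite (le_trans pu)// ler_pM2r // invr_gt0.
  have := Nc _ _ (linear_relationB lN Nu Nu').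
  have : hnorm (u - u') <= e / (c + 1).
    rewrite (le_trans (hnorm_trans p _ _))// (hdistC u).
    have -> : e / (c + 1) = e / (2 * (c + 1)) + e / (2 * (c + 1)).
      by field; rewrite gt_eqF // ltr_wpDl.
    by rewrite lerD.
  move=> /(ler_wpM2l c0) h1 h2; apply: (le_trans h2); apply: (le_trans h1).
  rewrite mulrA ler_pdivrMr ?ltr_wpDl//; nra.
exists k; apply/closure2P => e e0; have e2 : 0 < e / 2 by rewrite divr_gt0.
have [y [u [Nuy pu]]] := Pne _ e2; exists u, y; split=> //.
- apply: (le_lt_trans pu); rewrite ltr_pdivrMr//; nra.
- rewrite hdistC; apply: (@le_lt_trans _ _ (e / 2)); last by lra.
  by apply: Pk => //; exists u.
Qed.

(** A bounded relation extends to an operator on the whole space: close it and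
    precompose with the projection onto the closure of its domain.  The last
    clause identifies the value at [h] as the one at that projection [p]; when
    the domain is dense it gives [p = h]. *)
Lemma bounded_extension H K (N : set (H * K)) (c : R) :
    linear_relation N -> 0 <= c ->
    (forall h k, N (h, k) -> hnorm k <= c * hnorm h) ->
  exists f : {linear H -> K},
    [/\ forall h k, closure N (h, k) -> f h = k,
        forall h, hnorm (f h) <= c * hnorm h,
        forall h, orthocomp (rel_dom N) h -> f h = 0
      & forall h, exists2 p, closure N (p, f h) & orthocomp (rel_dom N) (h - p)].
Proof.
move=> lN c0 Nc.
have lcN := linear_closure lN.
have cNc h k : closure N (h, k) -> hnorm k <= c * hnorm h by exact: closure_bound.
have lD := linear_rel_dom lN.
have tot h : exists k, exists2 p, closure N (p, k) & orthocomp (rel_dom N) (h - p).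
  have [p [cp hp]] := subspace_projection h lD.
  have [k Nk] := bounded_closure_total lN c0 Nc cp.
  by exists k, p => //; apply/orthocompP.
have unique h k k' p p' : closure N (p, k) -> orthocomp (rel_dom N) (h - p) ->
    closure N (p', k') -> orthocomp (rel_dom N) (h - p') -> p = p' /\ k = k'.
  move=> Np hp Np' hp'; have Npp := linear_relationB lcN Np Np'.
  have op : orthocomp (rel_dom N) (p - p').
    have -> : p - p' = (h - p') - (h - p) by rewrite opprB [RHS]addrC addrA subrK.
    exact: (linear_subsetB (linear_orthocomp _) hp' hp).
  have pp0 : p - p' = 0.
    apply: rdotxx_eq0; rewrite le_eqVlt; apply/orP; left; apply/eqP.
    rewrite -[LHS]addr0 -[X in _ + X](rdot0r (k - k')).
    apply: closure_orth2 Npp => a b Nab; rewrite rdot0r addr0 rdotC.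
    by apply: orthocomp_rdot op _; exists b.
  split; first by apply/eqP; rewrite -subr_eq0 pp0.
  apply/eqP; rewrite -subr_eq0; apply/eqP/hnorm_eq0/le_anti.
  by rewrite hnorm_ge0 (le_trans (cNc _ _ Npp))// pp0 hnorm0 mulr0.
have [g gP] : exists g : H -> K, forall h,
    exists2 p, closure N (p, g h) & orthocomp (rel_dom N) (h - p).
  by exists (fun h => sval (cid (tot h))) => h; case: cid.
have gl a x y : g (a *: x + y) = a *: g x + g y.
  have [p Np hp] := gP x; have [q Nq hq] := gP y; have [r Nr hr] := gP (a *: x + y).
  have hpq : orthocomp (rel_dom N) (a *: x + y - (a *: p + q)).
    rewrite opprD addrACA -scalerBr.
    exact: linear_subsetP (linear_orthocomp _) hp hq.
  by have [] := unique _ _ _ _ _ Nr hr (linear_relationP a lcN Np Nq) hpq.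
have [f fg] := linear_fun_ex gl; exists f; split=> [h k Nhk|h|h hN|h]; rewrite ?fg//.
- have [p Np hp] := gP h.
  have hh : orthocomp (rel_dom N) (h - h).
    by rewrite subrr; exact: linear_subset0 (linear_orthocomp _).
  by have [] := unique _ _ _ _ _ Np hp Nhk hh.
- have [p Np hp] := gP h; rewrite (le_trans (cNc _ _ Np))// ler_wpM2l//.
  rewrite ler_hnorm2.
  suff : rdot p (h - p) = 0.
    have := rdotxx_ge0 (h - p); rewrite !rdotE (rdotC h p); lra.
  rewrite -[LHS]addr0 -[X in _ + X](rdot0r (g h)).
  apply: closure_orth2 Np => a b Nab; rewrite rdot0r addr0 rdotC.
  by apply: orthocomp_rdot hp _; exists b.
- have [p Np hp] := gP h; have h0 : orthocomp (rel_dom N) (h - 0) by rewrite subr0.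
  by have [] := unique _ _ _ _ _ Np hp (linear_relation0 lcN) h0.
Qed.

Lemma linear_op_graph H K (f : {linear H -> K}) : linear_relation (op_graph f).
Proof.
apply: linear_relationI => [|c x y u v]; rewrite /op_graph /=.
  by rewrite linear0.
by move=> -> ->; rewrite linearP.
Qed.

Lemma closed_op_graph H K (f : {linear H -> K}) (c : R) : 0 <= c ->
  (forall x, hnorm (f x) <= c * hnorm x) -> closed (op_graph f).
Proof.
move=> c0 fc [x y] /closure2P cf; rewrite /op_graph /=; apply/esym/eqP.
rewrite -subr_eq0 -(rwP eqP); apply/hnorm_eq0/le_anti; rewrite hnorm_ge0 andbT.
apply: (@le0_of_small _ _ (c + 1)) => e e0 _.
have [u [v [fuv xu yv]]] := cf _ e0.
rewrite (le_trans (hnorm_trans v _ _))// mulrDr mulr1 lerD //; last first.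
  by rewrite hdistC ltW.
have -> : v = f u by [].
rewrite -linearB (le_trans (fc _))// mulrC ler_wpM2r// ltW//.
Qed.

(** The adjoint graph of a bounded operator is itself bounded, and its domain is
    dense: for [k] orthogonal to it, decomposing [(0, k)] along the graph of [f]
    forces [k = 0].  Being closed it is then everywhere defined; this replaces
    the Riesz representation theorem. *)
Lemma bounded_adjoint H K (f : {linear H -> K}) (c : R) : 0 <= c ->
    (forall x, hnorm (f x) <= c * hnorm x) ->
  exists g : {linear K -> H}, [/\ forall x y, '[f x, y] = '[x, g y],
    forall x y, rdot (f x) y = rdot x (g y)
    & forall y, hnorm (g y) <= c * hnorm y].
Proof.
move=> c0 fc; pose N := adjoint (op_graph f).
have lf := linear_op_graph f; have clf := closed_op_graph c0 fc.
have lN : linear_relation N by exact: linear_adjoint.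
have Nc k h : N (k, h) -> hnorm h <= c * hnorm k.
  move=> Nkh; have := adjoint_rdot Nkh (erefl : op_graph f (h, f h)).
  rewrite rdotxx => hk; case: (eqVneq (hnorm h) 0) => [->|h0].
    by rewrite mulr_ge0 ?hnorm_ge0.
  have h1 : 0 < hnorm h by rewrite lt_neqAle eq_sym h0 hnorm_ge0.
  rewrite -(ler_pM2r h1) -expr2 hk (le_trans (cauchy_schwarz _ _))//.
  by rewrite mulrAC mulrC ler_wpM2r ?hnorm_ge0.
have [g [gN gc _ gdom]] := bounded_extension lN c0 Nc.
have dense k : orthocomp (rel_dom N) k -> k = 0.
  move=> Nk.
  have [x [y [u [v [/= fxy Nvu hE kE]]]]] := graph_decomposition 0 k lf clf.
  have xu : x = u by apply/eqP; rewrite -subr_eq0 -hE.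
  have k_v : rdot k v = 0 by apply: orthocomp_rdot Nk _; exists u.
  have Euv := adjoint_rdot Nvu fxy.
  have /rdotxx_eq0 v0 : rdot v v <= 0.
    have := rdotxx_ge0 u; move: k_v; rewrite kE rdotDl (rdotC y) -Euv xu; lra.
  have /rdotxx_eq0 u0 : rdot u u <= 0.
    have := rdotxx_ge0 v; move: k_v; rewrite kE rdotDl (rdotC y) -Euv xu; lra.
  by have fy : y = f x by []; rewrite kE v0 addr0 fy xu u0 linear0.
have gT y : N (y, g y).
  have [p Np /dense /eqP] := gdom y; rewrite subr_eq0 => /eqP yp.
  by apply: (closed_adjoint lf); rewrite [X in (X, _)]yp.
exists g; split=> [x y|x y|] //; last first.
  by rewrite rdotC -(adjoint_rdot (gT y) (erefl : op_graph f (x, f x))) rdotC.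
by rewrite dotC -(gT y (x, f x) (erefl _)) /= -dotC.
Qed.

End Adjoint.

(** * Square roots of bounded operators *)

Section SquareRootIteration.
Variables (R : realType) (H : hilbertType R) (E : {linear H -> H}).
Hypothesis Esym : forall x y, rdot (E x) y = rdot x (E y).
Hypothesis Ele : forall x, hnorm (E x) <= hnorm x.

(** With [X = 1 - E], a fixed point [Y] of [Y |-> (E + Y^2) / 2] satisfies
    [(1 - Y)^2 = X]. *)
Fixpoint sqrt_iter n (x : H) : H :=
  if n is m.+1 then (2^-1)%:C%C *: (E x + sqrt_iter m (sqrt_iter m x)) else 0.
Local Notation Y := sqrt_iter.

(** The same iteration for the scalar [E = 1].  It majorizes the operator
    iteration, including its increments ([sqrt_iter_diff]), so the convergence of
    this bounded monotone sequence gives convergence in norm. *)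
Fixpoint sqrt_bound n : R := if n is m.+1 then (1 + sqrt_bound m ^+ 2) / 2 else 0.
Local Notation y := sqrt_bound.

Lemma sqrt_bound_ge0 n : 0 <= y n.
Proof. by case: n => [|n] //=; rewrite divr_ge0 // addr_ge0 // sqr_ge0. Qed.

Lemma sqrt_bound_le1 n : y n <= 1.
Proof. by elim: n => [|n IH] //=; have := sqrt_bound_ge0 n; nra. Qed.

Lemma sqrt_boundS n : y n <= y n.+1.
Proof. by rewrite /=; have := sqr_ge0 (y n - 1); nra. Qed.

Lemma sqrt_iter_linear n c u v : Y n (c *: u + v) = c *: Y n u + Y n v.
Proof.
elim: n u v => [|n IH] u v /=; first by rewrite scaler0 addr0.
rewrite linearP 2!IH addrACA -(scalerDr c) [LHS]scalerDr; congr (_ + _).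
by rewrite !scalerA mulrC.
Qed.

Lemma sqrt_iterB n u v : Y n (u - v) = Y n u - Y n v.
Proof. by rewrite addrC -scaleN1r sqrt_iter_linear scaleN1r addrC. Qed.

Lemma sqrt_iter_sym n u v : rdot (Y n u) v = rdot u (Y n v).
Proof.
elim: n u v => [|n IH] u v /=; first by rewrite rdot0l rdot0r.
by rewrite !rdotE Esym !IH.
Qed.

Lemma sqrt_iter_bound n u : hnorm (Y n u) <= y n * hnorm u.
Proof.
elim: n u => [|n IH] u; first by rewrite /= hnorm0 mul0r.
rewrite [Y n.+1 u]/= hnormZ [y n.+1]/= ger0_norm // mulrAC mulrC ler_wpM2r //.
rewrite (le_trans (ler_hnormD _ _))// mulrDl mul1r lerD //.
by rewrite (le_trans (IH _))// expr2 -mulrA ler_wpM2l // sqrt_bound_ge0.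
Qed.

Lemma sqrt_iter_comm n (C : {linear H -> H}) u :
  (forall v, C (E v) = E (C v)) -> C (Y n u) = Y n (C u).
Proof.
move=> CE; elim: n u => [|n IH] u /=; first by rewrite linear0.
by rewrite linearZ linearD CE !IH.
Qed.

Lemma sqrt_iter_commE n m u : Y n (Y m u) = Y m (Y n u).
Proof.
have [F FY] := linear_fun_ex (sqrt_iter_linear n).
rewrite -!FY sqrt_iter_comm // => v; rewrite !FY.
by rewrite -sqrt_iter_comm.
Qed.

(** All iterates commute, so
    [Y_(n+2) - Y_(n+1) = (Y_(n+1) + Y_n) (Y_(n+1) - Y_n) / 2], in parallel with the
    scalar recursion. *)
Lemma sqrt_iter_diff n u : hnorm (Y n.+1 u - Y n u) <= (y n.+1 - y n) * hnorm u.
Proof.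
elim: n u => [|n IH] u.
  rewrite [Y 0 u]/= [Y 1 u]/= [y 1]/= [y 0]/= !subr0 addr0 hnormZ ger0_norm //.
  by rewrite expr0n addr0 mul1r ler_wpM2l.
have -> : Y n.+2 u - Y n.+1 u =
    (2^-1)%:C%C *: (Y n.+1 (Y n.+1 u - Y n u) + Y n (Y n.+1 u - Y n u)).
  rewrite 2!sqrt_iterB (sqrt_iter_commE n n.+1) addrA subrK.
  by rewrite [LHS]/= -scalerBr opprD addrACA subrr add0r.
have -> : y n.+2 - y n.+1 = 2^-1 * (y n.+1 * (y n.+1 - y n) + y n * (y n.+1 - y n)).
  have : y n.+2 = (1 + y n.+1 ^+ 2) / 2 by [].
  have : y n.+1 = (1 + y n ^+ 2) / 2 by [].
  by move: (y n.+2) (y n.+1) (y n) => y2 y1 y0; lra.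
rewrite hnormZ ger0_norm // -mulrA ler_wpM2l //.
rewrite (le_trans (ler_hnormD _ _))// mulrDl -(mulrA (y n.+1)) -(mulrA (y n)).
rewrite lerD //.
  by rewrite (le_trans (sqrt_iter_bound _ _))// ler_wpM2l ?sqrt_bound_ge0.
by rewrite (le_trans (sqrt_iter_bound _ _))// ler_wpM2l ?sqrt_bound_ge0.
Qed.

Lemma sqrt_iter_dist m n u : (m <= n)%N ->
  hnorm (Y n u - Y m u) <= (y n - y m) * hnorm u.
Proof.
move=> /subnK <-; elim: (n - m)%N => [|k IH].
  by rewrite !subrr hnorm0 mul0r.
rewrite (le_trans (hnorm_trans (Y (k + m) u) _ _))//.
have -> : y (k.+1 + m) - y m = (y (k + m).+1 - y (k + m)) + (y (k + m) - y m).
  by rewrite addSn; ring.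
by rewrite mulrDl lerD // sqrt_iter_diff.
Qed.

Let lim := sup (range y).
Let has_sup_y : has_sup (range y).
Proof.
split; first by exists (y 0), 0%N.
by exists 1 => _ [n _ <-]; exact: sqrt_bound_le1.
Qed.

Let gap n := lim - y n.

Let gap_ge0 n : 0 <= gap n.
Proof. by rewrite subr_ge0; apply: ub_le_sup; [case: has_sup_y|exists n]. Qed.

Let gap_small e : 0 < e -> exists n, gap n <= e.
Proof.
move=> e0; have [_ [n _ <-] yn] := sup_adherent e0 has_sup_y.
exists n; rewrite /gap; move: yn; rewrite -/lim; lra.
Qed.

Let le0_of_gap (r C : R) : (forall n, r <= gap n * C) -> r <= 0.
Proof.
move=> rC; apply: (@le0_of_small _ _ `|C|) => e e0 _.
have [n ne] := gap_small e0.
apply: (le_trans (rC n)); apply: (@le_trans _ _ (gap n * `|C|)).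
  by rewrite ler_wpM2l // ler_norm.
by rewrite ler_wpM2r.
Qed.

Let eq0_of_gap (v : H) (C : R) : (forall n, hnorm v <= gap n * C) -> v = 0.
Proof. by move=> /le0_of_gap v0; apply/hnorm_eq0/le_anti; rewrite v0 hnorm_ge0. Qed.

Lemma sqrt_iter_cvg u : exists l, forall n, hnorm (Y n u - l) <= gap n * hnorm u.
Proof.
pose P (e : R) := [set k | exists2 n, k = Y n u & gap n * hnorm u <= e].
have dist m n : hnorm (Y n u - Y m u) <= Num.max (gap n) (gap m) * hnorm u.
  wlog mn : m n / (m <= n)%N => [th|].
    by case/orP: (leq_total m n) => [/th//|/th]; rewrite hdistC maxC.
  apply: (le_trans (sqrt_iter_dist u mn)); rewrite ler_wpM2r ?hnorm_ge0//.
  by rewrite le_max; have := gap_ge0 n; rewrite /gap => h; apply/orP; right; lra.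
have [l Pl] : exists l, forall e x, 0 < e -> P e x -> hnorm (x - l) <= e.
  apply: cauchy_family => [e e0|e g e0 eg _ [n -> ne]|e _ _ e0 [n -> ne] [m -> me]].
  - have u1 : 0 < hnorm u + 1 by rewrite ltr_wpDl // hnorm_ge0.
    have /gap_small[n ne] : 0 < e / (hnorm u + 1) by rewrite divr_gt0.
    exists (Y n u), n => //.
    move: ne; rewrite ler_pdivlMr// => ne; apply: le_trans ne.
    by rewrite ler_wpM2l // lerDl.
  - by exists n => //; exact: le_trans eg.
  - apply: (le_trans (dist m n)); rewrite maxr_pMl ?hnorm_ge0//.
    by rewrite ge_max ne me.
exists l => n; apply/ler_addgt0Pr => e e0; apply: Pl.
  by rewrite ltr_wpDl // mulr_ge0 // hnorm_ge0.
by exists n => //; rewrite lerDl ltW.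
Qed.

Lemma sqrt_limit : exists Z : {linear H -> H},
  [/\ forall x v, rdot (Z x) v = rdot x (Z v),
      forall x, hnorm (Z x) <= hnorm x,
      forall x, (2%:R)%:C%C *: Z x = E x + Z (Z x)
    & forall (C : {linear H -> H}) c, (forall x, hnorm (C x) <= c * hnorm x) ->
        (forall v, C (E v) = E (C v)) -> forall v, C (Z v) = Z (C v)].
Proof.
have [L YL] : exists L : H -> H, forall u n, hnorm (Y n u - L u) <= gap n * hnorm u.
  by exists (fun u => sval (cid (sqrt_iter_cvg u))) => u; case: cid.
have Llin c u v : L (c *: u + v) = c *: L u + L v.
  apply/eqP; rewrite -subr_eq0; apply/eqP.
  apply: (@eq0_of_gap _
    (hnorm (c *: u + v) + complex.Re `|c| * hnorm u + hnorm v)) => n.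
  have -> : L (c *: u + v) - (c *: L u + L v) =
      (L (c *: u + v) - Y n (c *: u + v)) + c *: (Y n u - L u) + (Y n v - L v).
    by rewrite sqrt_iter_linear scalerBr; apply: rdot_inj => w; rewrite !rdotE; ring.
  have c0 : 0 <= complex.Re `|c| by have := normr_ge0 c; rewrite lecE => /andP[].
  rewrite (le_trans (ler_hnormD _ _))// mulrDr lerD //.
  rewrite (le_trans (ler_hnormD _ _))// mulrDr lerD //; first by rewrite hdistC.
  by rewrite hnormZc mulrCA ler_wpM2l.
have [Z ZL] := linear_fun_ex Llin.
have YZ u n : hnorm (Y n u - Z u) <= gap n * hnorm u by rewrite ZL.
have ZY u n : hnorm (Z u - Y n u) <= gap n * hnorm u by rewrite hdistC.
have Zle x : hnorm (Z x) <= hnorm x.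
  rewrite -subr_le0; apply: (@le0_of_gap _ (hnorm x)) => n.
  rewrite lerBlDr -[X in hnorm X <= _](subrK (Y n x)).
  rewrite (le_trans (ler_hnormD _ _))// lerD //.
  rewrite (le_trans (sqrt_iter_bound _ _))// -[leRHS]mul1r.
  by rewrite ler_wpM2r ?hnorm_ge0// sqrt_bound_le1.
exists Z; split=> // [x v|x|C c Cc CE v].
- apply/eqP; rewrite -subr_eq0 -normr_eq0 eq_le normr_ge0 andbT.
  apply: (@le0_of_gap _ (hnorm x * hnorm v + hnorm x * hnorm v)) => n.
  have -> : rdot (Z x) v - rdot x (Z v) = rdot (Z x - Y n x) v + rdot x (Y n v - Z v).
    by rewrite !rdotE sqrt_iter_sym; ring.
  rewrite (le_trans (ler_normD _ _))// mulrDr lerD //.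
    by rewrite (le_trans (cauchy_schwarz_abs _ _))// mulrA ler_wpM2r ?hnorm_ge0.
  by rewrite (le_trans (cauchy_schwarz_abs _ _))// mulrCA ler_wpM2l ?hnorm_ge0.
- apply/eqP; rewrite -subr_eq0; apply/eqP.
  apply: (@eq0_of_gap _ (2 * hnorm x + hnorm (Z x) + hnorm x)) => n.
  have -> : (2%:R)%:C%C *: Z x - (E x + Z (Z x)) =
      (2%:R)%:C%C *: (Z x - Y n.+1 x) + (Y n (Z x) - Z (Z x)) + Y n (Y n x - Z x).
    rewrite sqrt_iterB /=.
    by apply: rdot_inj => w; rewrite !rdotE; field.
  rewrite (le_trans (ler_hnormD _ _))// mulrDr lerD //.
    rewrite (le_trans (ler_hnormD _ _))// mulrDr lerD //.
    rewrite hnormZ ger0_norm // mulrCA ler_wpM2l //.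
    rewrite (le_trans (ZY _ _))// ler_wpM2r ?hnorm_ge0// lerB //.
    exact: sqrt_boundS.
  rewrite (le_trans (sqrt_iter_bound _ _))// (le_trans _ (YZ x n))//.
  by rewrite -[leRHS]mul1r ler_wpM2r ?hnorm_ge0// sqrt_bound_le1.
- apply/eqP; rewrite -subr_eq0; apply/eqP.
  apply: (@eq0_of_gap _ (`|c| * hnorm v + hnorm (C v))) => n.
  have -> : C (Z v) - Z (C v) = C (Z v - Y n v) + (Y n (C v) - Z (C v)).
    by rewrite linearB sqrt_iter_comm // addrA subrK.
  rewrite (le_trans (ler_hnormD _ _))// mulrDr lerD //.
  rewrite (le_trans (Cc _))// mulrCA (le_trans (ler_wpM2r (hnorm_ge0 _) (ler_norm c)))//.
  by rewrite ler_wpM2l.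
Qed.

End SquareRootIteration.

Section SquareRoot.
Variables (R : realType) (H : hilbertType R).

(** Expanding [|x - Z x|^2 <= |x|^2] gives [|Z x|^2 <= 2 <Z x, x>]. *)
Lemma accretive_bound (Z : {linear H -> H}) :
  (forall x, hnorm (x - Z x) <= hnorm x) ->
  (forall x, hnorm (Z x) <= 2 * hnorm x) /\ (forall x, 0 <= rdot (Z x) x).
Proof.
move=> Zc; split=> x.
  have -> : Z x = x - (x - Z x) by rewrite subKr.
  have := ler_hnormD x (- (x - Z x)); rewrite hnorm_opp; have := Zc x; lra.
have := Zc x; rewrite ler_hnorm2 !rdotE (rdotC x (Z x)).
have := rdotxx_ge0 (Z x); lra.
Qed.

(** The hypothesis [|x - X x| <= |x|] is inherited by the root [Z].  So the lemma
    can be iterated, and positivity of all operators concerned comes from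
    [accretive_bound]. *)
Lemma bounded_sqrt (X : {linear H -> H}) :
    (forall x y, rdot (X x) y = rdot x (X y)) ->
    (forall x, hnorm (x - X x) <= hnorm x) ->
  exists Z : {linear H -> H},
    [/\ forall x y, rdot (Z x) y = rdot x (Z y),
        forall x, hnorm (x - Z x) <= hnorm x,
        forall x, Z (Z x) = X x
      & forall (C : {linear H -> H}) c, (forall x, hnorm (C x) <= c * hnorm x) ->
          (forall v, C (X v) = X (C v)) -> forall v, C (Z v) = Z (C v)].
Proof.
move=> Xsym Xc.
have [E EE] : exists E : {linear H -> H}, forall x, E x = x - X x.
  apply: linear_fun_ex => c x y; rewrite linearP scalerBr.
  by apply: rdot_inj => w; rewrite !rdotE; ring.
have [||Y [Ysym Yc Y2 YC]] := @sqrt_limit _ _ E.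
- by move=> x y; rewrite !EE !rdotE Xsym.
- by move=> x; rewrite EE.
have [Z ZE] : exists Z : {linear H -> H}, forall x, Z x = x - Y x.
  apply: linear_fun_ex => c x y; rewrite linearP scalerBr.
  by apply: rdot_inj => w; rewrite !rdotE; ring.
exists Z; split=> [x y|x|x|C c Cc CX v].
- by rewrite !ZE !rdotE Ysym.
- by rewrite ZE subKr.
- rewrite !ZE linearB; apply: rdot_inj => w; rewrite !rdotE.
  have := congr1 (fun u => rdot u w) (Y2 x); rewrite EE !rdotE; lra.
- by rewrite !ZE linearB (YC C c Cc) // => u; rewrite !EE linearB CX.
Qed.

End SquareRoot.

(** * Operator parts, resolvents and unbounded square roots *)

Section SelfAdjoint.
Variables (R : realType).
Implicit Types (H K L : hilbertType R).

Lemma nonneg_rdot H (S : set (H * H)) x y : nonneg_rel S -> S (x, y) -> 0 <= rdot y x.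
Proof. by move=> S0 /S0 /=; rewrite lecE => /andP[]. Qed.

Lemma nonneg_relI H (S : set (H * H)) : S `<=` adjoint S ->
  (forall x y, S (x, y) -> 0 <= rdot y x) -> nonneg_rel S.
Proof.
move=> SS S0 [x y] Sxy /=; rewrite lecE; apply/andP; split; last exact: S0.
have := SS _ Sxy _ Sxy => /= E; move: (E); rewrite (dotC x y) E.
by case: '[x, y] => a b [] /eqP; rewrite -subr_eq0 opprK -mulr2n mulrn_eq0.
Qed.

Lemma selfadjoint_linear H (S : set (H * H)) : selfadjoint S -> linear_relation S.
Proof. by move=> ->; exact: linear_adjoint. Qed.

Lemma selfadjoint_closed H (S : set (H * H)) : selfadjoint S -> closed S.
Proof.
by move=> sS; rewrite sS; apply: closed_adjoint; exact: selfadjoint_linear.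
Qed.

Lemma selfadjoint_rdot H (S : set (H * H)) x y u v : selfadjoint S ->
  S (x, y) -> S (u, v) -> rdot y u = rdot x v.
Proof. by move=> sS; rewrite {1}sS; exact: adjoint_rdot. Qed.

Lemma selfadjoint_sub_eq H (S T : set (H * H)) :
  selfadjoint S -> selfadjoint T -> S `<=` T -> S = T.
Proof.
move=> sS sT ST; apply/seteqP; split=> //.
by rewrite sS sT; exact: adjointS.
Qed.

Lemma orthocompK H (M : set H) : linear_subset M -> closed M ->
  orthocomp (orthocomp M) = M.
Proof.
move=> lM clM; apply/seteqP; split=> [x xM|x Mx].
  have [m [/clM Mm xm]] := subspace_projection x lM.
  have xmM : orthocomp M (x - m) by apply/orthocompP.
  have /rdotxx_eq0/eqP : rdot (x - m) (x - m) <= 0.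
    by rewrite rdotBl (orthocomp_rdot xM xmM) (rdotC m) xm // subrr.
  by rewrite subr_eq0 => /eqP ->.
apply/orthocompP; first exact: linear_orthocomp.
by move=> y /orthocomp_rdot/(_ Mx); rewrite rdotC.
Qed.

Lemma closed_rel_mul H K (T : set (H * K)) : closed T -> closed (rel_mul T).
Proof.
move=> clT y /closureP cy; apply: clT; apply/closure2P => e /cy[z Tz yz].
by exists 0, z; split=> //; rewrite subrr hnorm0; apply: le_lt_trans yz; exact: hnorm_ge0.
Qed.

(** For closed [T] the projection defining [op_part] moves [y] by an element of
    [mul T], hence stays inside [T]. *)
Lemma op_partP H K (T : set (H * K)) x y : linear_relation T -> closed T ->
  op_part T (x, y) <-> T (x, y) /\ orthocomp (rel_mul T) y.
Proof.
move=> lT clT; have lM := linear_rel_mul lT.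
split=> [[z /= Txz [/= My]]|[Txy My]].
  rewrite orthocompK //; last exact: closed_rel_mul.
  move=> Mzy; split=> //; rewrite -[x]subr0 -[y](subKr z).
  exact: linear_relationB Mzy.
exists y => //; split=> //=; rewrite subrr.
exact: linear_subset0 (linear_orthocomp _).
Qed.

Lemma op_part_ex H K (T : set (H * K)) x y : linear_relation T -> closed T ->
  T (x, y) -> exists z, [/\ op_part T (x, z), rel_mul T (y - z) & hnorm z <= hnorm y].
Proof.
move=> lT clT Txy; have lM := linear_rel_mul lT; have clM := closed_rel_mul clT.
have [m [/clM Mm ym]] := subspace_projection y lM.
exists (y - m); split; last 2 first.
- by rewrite subKr.
- by have := ym _ Mm; rewrite ler_hnorm2 !rdotE (rdotC m y) => h;
    have := rdotxx_ge0 m; lra.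
apply/op_partP => //; split; last exact/orthocompP.
by rewrite -[x]subr0; exact: linear_relationB.
Qed.

Lemma op_part_sub H K (T : set (H * K)) : linear_relation T -> closed T ->
  op_part T `<=` T.
Proof. by move=> lT clT [x y] /op_partP[]. Qed.

Lemma op_part_linear H K (T : set (H * K)) : linear_relation T -> closed T ->
  linear_relation (op_part T).
Proof.
move=> lT clT; apply: linear_relationI => [|c x y u v].
  apply/op_partP => //; split; first exact: linear_relation0.
  exact: linear_subset0 (linear_orthocomp _).
move=> /op_partP[//|//|Tx Mx] /op_partP[//|//|Tu Mu]; apply/op_partP => //.
split; first exact: linear_relationP.
exact: linear_subsetP (linear_orthocomp _) Mx Mu.
Qed.

Lemma op_part_closed H K (T : set (H * K)) : linear_relation T -> closed T ->
  closed (op_part T).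
Proof.
move=> lT clT [x y] cT; apply/op_partP => //; split.
  by apply: (clT); exact: (closureS (op_part_sub lT clT) cT).
apply/orthocompP; first exact: linear_rel_mul.
move=> z Mz; rewrite -[LHS]add0r -[X in X + _](rdot0r x).
apply: closure_orth2 cT => a b /op_partP[//|//|_ Mb].
by rewrite rdot0r add0r; exact: orthocomp_rdot Mb Mz.
Qed.

Lemma op_part_fun H K (T : set (H * K)) x y z : linear_relation T -> closed T ->
  op_part T (x, y) -> op_part T (x, z) -> y = z.
Proof.
move=> lT clT /op_partP[//|//|Txy My] /op_partP[//|//|Txz Mz].
apply/eqP; rewrite -subr_eq0; apply/eqP/rdotxx_eq0.
rewrite (orthocomp_rdot (M := rel_mul T)) //.
  exact: linear_subsetB (linear_orthocomp _) My Mz.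
by rewrite /rel_mul /= -(subrr x); exact: linear_relationB.
Qed.

Lemma selfadjoint_closure_dom H (S : set (H * H)) : selfadjoint S ->
  closure (rel_dom S) = orthocomp (rel_mul S).
Proof.
move=> sS; have lS := selfadjoint_linear sS.
have lM := linear_rel_mul lS.
have cdom x : closure (rel_dom S) x -> orthocomp (rel_mul S) x.
  move=> cx; apply/orthocompP => // m Sm; apply: closure_orth cx => a [b Sab].
  by rewrite rdotC (selfadjoint_rdot sS Sm Sab) rdot0l.
apply/seteqP; split=> // x Mx.
have [m [cm xm]] := subspace_projection x (linear_rel_dom lS).
have /(orthocomp_rdot _) xm0 : rel_mul S (x - m).
  rewrite /rel_mul sS /=; apply/adjointP => // a b Sab.
  by rewrite rdot0l xm //; exists b.
have /rdotxx_eq0/eqP : rdot (x - m) (x - m) <= 0.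
  by rewrite xm0 //; exact: linear_subsetB (linear_orthocomp _) Mx (cdom _ cm).
by rewrite subr_eq0 => /eqP ->.
Qed.

(** The map [x + y |-> x] over [S] is a contraction, since [<y, x> >= 0].  Its
    domain is dense, because [d] orthogonal to all [x + y] means that [(d, - d)] is in
    [S^* = S], which is nonnegative only for [d = 0]. *)
Lemma resolvent_ex H (S : set (H * H)) : selfadjoint S -> nonneg_rel S ->
  exists A : {linear H -> H},
    (forall x y, S (x, y) -> A (x + y) = x) /\ (forall h, S (A h, h - A h)).
Proof.
move=> sS S0; have lS := selfadjoint_linear sS.
pose N := [set p : H * H | S (p.2, p.1 - p.2)].
have lN : linear_relation N.
  apply: linear_relationI => [|c x y u v]; rewrite /N /= ?subr0.
    exact: linear_relation0.
  move=> Sx Su; rewrite opprD addrACA -scalerBr; exact: linear_relationP.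
have Nc h k : N (h, k) -> hnorm k <= 1 * hnorm h.
  rewrite /N /= mul1r => /(nonneg_rdot S0); rewrite ler_hnorm2.
  have := rdotxx_ge0 (h - k); rewrite !rdotE (rdotC k h); lra.
have [A [AN _ _ Adom]] := bounded_extension lN ler01 Nc.
have dense d : orthocomp (rel_dom N) d -> d = 0.
  move=> Nd; have : S (d, - d).
    rewrite sS; apply/adjointP => // x y Sxy.
    have := orthocomp_rdot Nd (y := x + y); rewrite rdotNl rdotDr => E.
    have : rdot d x + rdot d y = 0 by apply: E; exists x; rewrite /N /= addrC addKr.
    by lra.
  by move=> /(nonneg_rdot S0); rewrite rdotNl oppr_ge0; exact: rdotxx_eq0.
have clN : closure N `<=` N.
  move=> [h k] /closure2P cN; apply: (selfadjoint_closed sS); apply/closure2P => e e0.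
  have [u [v [Nuv hu kv]]] := cN _ (divr_gt0 e0 (ltr0Sn _ 1)).
  exists v, (u - v); split=> //=; first by lra.
  have -> : h - k - (u - v) = (h - u) - (k - v).
    by apply: rdot_inj => w; rewrite !rdotE; ring.
  have := ler_hnormD (h - u) (- (k - v)); rewrite hnorm_opp; lra.
exists A; split=> [x y Sxy|h].
  by apply: AN; apply: subset_closure; rewrite /N /= addrC addKr.
have [p Np /dense/eqP] := Adom h; rewrite subr_eq0 => /eqP hp.
by have := clN _ Np; rewrite /N /= -hp.
Qed.

(** Let [A = (1 + S)^-1], [a = A^(1/2)] and [b = (1 - A)^(1/2)], which commute and
    satisfy [a^2 + b^2 = 1].  Formally [S = A^-1 (1 - A)], so its root is
    [b a^-1], with graph [(a u, b u)].  Restricting [u] to the orthocomplement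
    of [mul S = ker a] leaves out the multivalued part.  A further root [c] of
    [a] shows that [a b = c b c] is nonnegative. *)
Lemma sqrt_op_ex H (S : set (H * H)) : selfadjoint S -> nonneg_rel S ->
  exists Q, is_sqrt_op S Q.
Proof.
move=> sS S0; have lS := selfadjoint_linear sS; have clS := selfadjoint_closed sS.
have lM := linear_rel_mul lS; have clM := closed_rel_mul clS.
have [A [AS SA]] := resolvent_ex sS S0.
have Asym x y : rdot (A x) y = rdot x (A y).
  have := selfadjoint_rdot sS (SA x) (SA y); rewrite !rdotE; lra.
have Ale x : hnorm (A x) <= hnorm x.
  rewrite ler_hnorm2; have := nonneg_rdot S0 (SA x).
  have := rdotxx_ge0 (x - A x); rewrite !rdotE (rdotC (A x) x); lra.
have A1le x : hnorm (x - A x) <= hnorm x.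
  rewrite ler_hnorm2; have := nonneg_rdot S0 (SA x).
  have := rdotxx_ge0 (A x); rewrite !rdotE (rdotC (A x) x); lra.
have [a [asym ac a2 aC]] := bounded_sqrt Asym A1le.
have [A1 A1E] : exists A1 : {linear H -> H}, forall x, A1 x = x - A x.
  apply: linear_fun_ex => c x y; rewrite linearP scalerBr.
  by apply: rdot_inj => w; rewrite !rdotE; ring.
have [||b [bsym bc b2 bC]] := @bounded_sqrt _ _ A1.
- by move=> x y; rewrite !A1E !rdotE Asym.
- by move=> x; rewrite A1E subKr.
have [a_bd a_ge0] := accretive_bound ac.
have [b_bd b_ge0] := accretive_bound bc.
have aA x : a (A x) = A (a x) by rewrite -!a2.
have ab x : a (b x) = b (a x).
  by apply: bC a_bd _ _ => u; rewrite !A1E linearB aA.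
have [c [csym cc c2 cC]] := bounded_sqrt asym ac.
have bcomm x : b (c x) = c (b x) by apply: cC b_bd _ _ => u; rewrite ab.
pose M := orthocomp (rel_mul S).
have lMo : linear_subset M by exact: linear_orthocomp.
have kera m : a m = 0 <-> rel_mul S m.
  split=> [am|Sm].
    by have := SA m; rewrite -a2 am linear0 subr0.
  have : A m = 0 by have := AS _ _ Sm; rewrite add0r.
  by move=> Am; apply: rdotxx_eq0; rewrite asym a2 Am rdot0r.
have Ma u : M (a u).
  by apply/orthocompP => // m /kera am; rewrite asym am rdot0r.
have Mb u : M u -> M (b u).
  move=> Mu; apply/orthocompP => // m /kera am.
  by rewrite bsym; apply: orthocomp_rdot Mu _; apply/kera; rewrite ab am linear0.
have ainj u : M u -> a u = 0 -> u = 0.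
  by move=> Mu /kera Su; apply: rdotxx_eq0; rewrite (orthocomp_rdot Mu Su).
have E x : a (a x) + b (b x) = x by rewrite a2 b2 A1E addrC subrK.
pose Q := [set p : H * H | exists2 u, M u & p = (a u, b u)].
have lQ : linear_relation Q.
  apply: linear_relationI => [|k _ _ _ _ [u Mu [-> ->]] [v Mv [-> ->]]].
    by exists 0; rewrite ?linear0 //; exact: linear_subset0.
  by exists (k *: u + v); [exact: linear_subsetP lMo Mu Mv|rewrite !linearP].
have Qadj : Q `<=` adjoint Q.
  move=> _ [u Mu ->]; apply/adjointP => // _ _ [v Mv [-> ->]].
  by rewrite -asym ab bsym.
exists Q; split.
- apply/seteqP; split=> [y [u Mu [/esym/(ainj _ Mu) -> ->]]|_ ->].
    by rewrite /= linear0.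
  exact: linear_relation0.
- rewrite /selfadjoint_in selfadjoint_closure_dom // -/M.
  apply/seteqP; split=> [p Qp|[v w] [adj [/= Mv Mw]]].
    by split; [exact: Qadj|case: Qp => u Mu ->; split=> /=; [exact: Ma|exact: Mb]].
  (* Membership in the adjoint only tests against [d] orthogonal to [mul S];
     the difference [a w - b v] is itself such a [d]. *)
  have wv : a w = b v.
    apply/eqP; rewrite -subr_eq0; apply/eqP/rdotxx_eq0.
    set d := a w - b v.
    have Md : M d by exact: linear_subsetB lMo (Ma w) (Mb _ Mv).
    have := adjoint_rdot adj (ex_intro2 _ _ d Md erefl : Q (a d, b d)).
    by rewrite -asym -bsym => h; rewrite {1}/d rdotBl h subrr.
  exists (a v + b w); first exact: linear_subsetD lMo (Ma v) (Mb _ Mw).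
  have -> : a (a v + b w) = v by rewrite linearD ab wv E.
  by rewrite linearD -ab -wv E.
- apply: nonneg_relI => // _ _ [u Mu [-> ->]].
  have <- : c (c u) = a u by rewrite c2.
  by rewrite -csym -bcomm b_ge0.
- apply/seteqP; split=> [[x z] [y [u Mu [-> ->]] [u' Mu' /= [bu ->]]]|[x z] /op_partP[//|//|Sxz Mz]].
    apply/op_partP => //; split; last exact: Mb.
    have Aau : A (a u + b u') = a u.
      by rewrite -a2 linearD (ab u') -bu -[in RHS](E u) !linearD !ab.
    by have := SA (a u + b u'); rewrite Aau addrAC subrr add0r.
  have Mx : M x by rewrite /M -selfadjoint_closure_dom //; apply: subset_closure; exists z.
  have Mh : M (x + z) by exact: linear_subsetD lMo Mx Mz.
  have xE : x = a (a (x + z)) by rewrite a2 AS.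
  have zE : z = b (b (x + z)) by rewrite b2 A1E AS // addrC addKr.
  exists (b (a (x + z))); first by exists (a (x + z)); rewrite //= -xE.
  by exists (b (x + z)); [exact: Mb|rewrite /= ab -zE].
Qed.

Lemma sqrt_opP H (S : set (H * H)) : selfadjoint S -> nonneg_rel S ->
  is_sqrt_op S (sqrt_op S).
Proof. by move=> sS S0; exact: xgetPex (sqrt_op_ex sS S0). Qed.

End SelfAdjoint.

(** * The form of a nonnegative selfadjoint relation *)

Section Forms.
Variables (R : realType).
Implicit Types (H K L : hilbertType R).

Section SquareRootProperties.
Variables (H : hilbertType R) (S Q : set (H * H)).
Hypotheses (sS : selfadjoint S) (sQ : is_sqrt_op S Q).

Let M := orthocomp (rel_mul S).
Let lM : linear_subset M. Proof. exact: linear_orthocomp. Qed.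
Let lS : linear_relation S. Proof. exact: selfadjoint_linear. Qed.
Let clS : closed S. Proof. exact: selfadjoint_closed. Qed.

Let QE : Q = adjoint Q `&` (M `*` M).
Proof. by case: sQ => _ E _ _; rewrite /M -selfadjoint_closure_dom. Qed.

Lemma sqrt_op_linear : linear_relation Q.
Proof.
have lA := linear_adjoint Q.
rewrite QE; apply: linear_relationI => [|c x y u v].
  split; first exact: linear_relation0.
  by split; exact: linear_subset0 lM.
move=> [Ax [/= Mx My]] [Au [/= Mu Mv]]; split.
  exact: linear_relationP lA Ax Au.
by split; [exact: linear_subsetP lM Mx Mu|exact: linear_subsetP lM My Mv].
Qed.

Lemma sqrt_op_closed : closed Q.
Proof.
have clM : closed M by apply: closed_orthocomp; exact: linear_rel_mul.
have clA := closed_adjoint sqrt_op_linear.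
move=> [x y] cQ; rewrite QE; have {}cQ := cQ.
have sub : Q `<=` adjoint Q /\ forall p, Q p -> M p.1 /\ M p.2.
  by split=> p; rewrite {1}QE => -[].
split; first by apply: clA; exact: closureS sub.1 _ cQ.
move/closure2P: cQ => cQ; split; apply: clM; apply/closureP => e /cQ[u [v [Quv xu yv]]].
  by exists u => //; have [] := sub.2 _ Quv.
by exists v => //; have [] := sub.2 _ Quv.
Qed.

Lemma sqrt_op_mul x : Q (0, x) -> x = 0.
Proof. by case: sQ => Q0 _ _ _; have : rel_mul Q x -> [set 0] x by rewrite Q0. Qed.

(** The adjoint of [Q] taken in the whole space is [Q] plus all pairs orthogonal
    to the closure of [dom S]; the second components of these pairs restore
    exactly [mul S]. *)
Lemma sqrt_op_comp : (adjoint Q \; Q)%relation = S.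
Proof.
have [_ _ _ QQ] := sQ.
have lmS := linear_rel_mul lS; have clmS := closed_rel_mul clS.
have split_mul w : exists m, rel_mul S m /\ M (w - m).
  have [m [/clmS Sm wm]] := subspace_projection w lmS.
  by exists m; split=> //; apply/orthocompP.
have QM x y : Q (x, y) -> M x /\ M y by rewrite {1}QE => -[].
have Qadj x y : Q (x, y) -> adjoint Q (x, y) by rewrite {1}QE => -[].
apply/seteqP; split=> [[x w] [y /= Qxy Ayw]|[x w] Sxw].
  have [m [Sm Mwm]] := split_mul w.
  have Qym : Q (y, w - m).
    rewrite QE; split; last by split=> //=; have [] := QM _ _ Qxy.
    apply/adjointP; first exact: sqrt_op_linear.
    move=> u v Quv; rewrite rdotBl (adjoint_rdot Ayw Quv).
    by rewrite (rdotC m) (orthocomp_rdot (QM _ _ Quv).1 Sm) subr0.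
  have : op_part S (x, w - m) by rewrite -QQ; exists y.
  move=> /op_partP[//|//|Sx _]; rewrite -[x]addr0 -[w](subrK m).
  exact: linear_relationD.
have [m [Sm Mwm]] := split_mul w.
have : op_part S (x, w - m).
  by apply/op_partP => //; split=> //; rewrite -[x]subr0; exact: linear_relationB.
rewrite -QQ => -[y /= Qxy Qyw]; exists y => //=.
apply/adjointP; first exact: sqrt_op_linear.
move=> u v Quv; rewrite -(adjoint_rdot (Qadj _ _ Qyw) Quv) rdotBl.
by rewrite (rdotC m) (orthocomp_rdot (QM _ _ Quv).1 Sm) subr0.
Qed.

End SquareRootProperties.

(** This is the decomposition of [(h, 0)] along [T]. *)
Lemma range_1_adjoint_comp H K (T : set (H * K)) h :
    linear_relation T -> closed T ->
  exists x y z, [/\ T (x, y), adjoint T (y, z) & h = x + z].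
Proof.
move=> lT clT; have [x [y [u [v [Txy Avu hE /esym/eqP]]]]] := graph_decomposition h 0 lT clT.
rewrite addr_eq0 => /eqP yE; exists x, y, (- u); split=> //.
rewrite yE -(scaleN1r v) -(scaleN1r u).
exact: linear_relationZ (linear_adjoint T) Avu.
Qed.

(** A symmetric relation [S] for which [1 + S] is onto is selfadjoint: a pair in
    [S^*] differs from one in [S] by some [(d, - d)] in [S^*], and such a [d] is
    orthogonal to the range of [1 + S]. *)
Lemma selfadjoint_adjoint_comp H K (T : set (H * K)) :
  linear_relation T -> closed T -> selfadjoint (adjoint T \; T)%relation.
Proof.
move=> lT clT; have lA := linear_adjoint T; set S := (_ \; _)%relation.
have lS : linear_relation S by exact: linear_comp.
have SS : S `<=` adjoint S.
  move=> [x z] [y /= Txy Ayz]; apply/adjointP => // u w [v /= Tuv Avw].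
  by rewrite (adjoint_rdot Ayz Tuv) (rdotC x) (adjoint_rdot Avw Txy) rdotC.
apply/seteqP; split=> // -[x z] Axz.
have [u [v [w [Tuv Avw E]]]] := range_1_adjoint_comp (x + z) lT clT.
have Suw : S (u, w) by exists v.
have AB : adjoint S (x - u, z - w) by exact: linear_relationB (linear_adjoint S) Axz (SS _ Suw).
have zw : z - w = - (x - u).
  by apply: rdot_inj => t; have := congr1 (fun r => rdot r t) E; rewrite !rdotE; lra.
have [a [b [c [Tab Abc dE]]]] := range_1_adjoint_comp (x - u) lT clT.
have Sac : S (a, c) by exists b.
have /rdotxx_eq0/eqP : rdot (x - u) (x - u) <= 0.
  have := adjoint_rdot AB Sac; rewrite zw {4}dE rdotNl rdotDr; lra.
rewrite subr_eq0 => /eqP xu; move: zw; rewrite xu subrr oppr0 => /eqP.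
by rewrite subr_eq0 => /eqP ->.
Qed.

Lemma nonneg_adjoint_comp H K (T : set (H * K)) :
  linear_relation T -> closed T -> nonneg_rel (adjoint T \; T)%relation.
Proof.
move=> lT clT; apply: nonneg_relI.
  by rewrite -(selfadjoint_adjoint_comp lT clT).
by move=> x z [y /= Txy Ayz]; rewrite (adjoint_rdot Ayz Txy) rdotxx_ge0.
Qed.

(** The domain of [T^* T] is a core of [T_s]: if [(d, e)] in [T] is orthogonal to
    the restricted graph, then [d] is orthogonal to the range of [1 + T^* T],
    that is to everything, and [e] is in [mul T]. *)
Lemma adjoint_comp_core H K (T : set (H * K)) x y :
    linear_relation T -> closed T -> op_part T (x, y) ->
  closure [set p | T p /\ rel_dom (adjoint T) p.2] (x, y).
Proof.
move=> lT clT /op_partP[//|//|Txy My].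
set N := [set p | _]; have lA := linear_adjoint T; have lD := linear_rel_dom lA.
have lN : linear_relation N.
  apply: linear_relationI.
    by split; [exact: linear_relation0|exact: linear_subset0 lD].
  move=> c a b u v [Ta Aa] [Tu Au]; split; first exact: linear_relationP.
  exact: linear_subsetP lD Aa Au.
have NT : closure N `<=` T by move=> p cp; apply: clT; apply: closureS cp => q [].
have [p [q [cN orth]]] := graph_projection x y (linear_closure lN) (@closed_closure _ _).
have Tpq := NT _ cN.
have xp : x - p = 0.
  apply: rdotxx_eq0.
  have [u [v [w [Tuv Avw E]]]] := range_1_adjoint_comp (x - p) lT clT.
  have Nuv : closure N (u, v) by apply: subset_closure; split=> //; exists w.
  have o := orth _ _ Nuv; have a := adjoint_rdot Avw (linear_relationB lT Txy Tpq).
  by rewrite [X in rdot _ X]E rdotDr (rdotC _ w) a (rdotC v) o.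
have Tyq : rel_mul T (y - q) by rewrite /rel_mul /= -xp; exact: linear_relationB.
have qyq : rdot q (y - q) = 0.
  rewrite -[LHS]add0r -[X in X + _](rdot0r p).
  apply: closure_orth2 cN => a b [_ [c /= Abc]].
  by rewrite rdot0r add0r -(adjoint_rdot Abc Tyq) rdot0r.
have yq : y - q = 0.
  by apply: rdotxx_eq0; rewrite rdotBl qyq (orthocomp_rdot My Tyq) subrr.
by rewrite -(subrK p x) -(subrK q y) xp yq !add0r.
Qed.

(** On the core the values of [T2] are a bounded function [J] of those of [T1].
    The pairs [(u, v)] with [(u, J v)] in the operator part of [T2] form a closed
    set, which therefore contains the closure of the core. *)
Lemma form_le_of_core H K L (T1 : set (H * K)) (T2 : set (H * L)) (c : R) : 0 <= c ->
    linear_relation T1 -> closed T1 -> linear_relation T2 -> closed T2 ->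
    (forall u v w, T1 (u, v) -> adjoint T1 (v, w) ->
      exists2 y, T2 (u, y) & hnorm y <= c * hnorm v) ->
  forall u v, T1 (u, v) -> exists2 y, op_part T2 (u, y) & hnorm y <= c * hnorm v.
Proof.
move=> c0 lT1 clT1 lT2 clT2 le12.
have lo := op_part_linear lT2 clT2; have clo := op_part_closed lT2 clT2.
pose N := [set p : K * L | exists2 u, T1 (u, p.1) /\ rel_dom (adjoint T1) p.1
  & op_part T2 (u, p.2)].
have lD := linear_rel_dom (linear_adjoint T1).
have lN : linear_relation N.
  apply: linear_relationI => [|k x y x' y' [u [/= Tu Du] ou] [u' [/= Tu' Du'] ou']].
    exists 0; last exact: linear_relation0.
    by split; [exact: linear_relation0|exact: linear_subset0].
  exists (k *: u + u'); last exact: linear_relationP.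
  by split; [exact: linear_relationP|exact: linear_subsetP lD Du Du'].
have Nc v y : N (v, y) -> hnorm y <= c * hnorm v.
  move=> [u [/= Tuv [w Avw]] ou]; have [z Tuz zv] := le12 _ _ _ Tuv Avw.
  have [z' [oz' _ zz']] := op_part_ex lT2 clT2 Tuz.
  by rewrite (op_part_fun lT2 clT2 ou oz') (le_trans zz').
have [J [JN Jc _ _]] := bounded_extension lN c0 Nc.
move=> u v Tuv; have [v' [ov' _ vv']] := op_part_ex lT1 clT1 Tuv.
exists (J v'); last by rewrite (le_trans (Jc _))// ler_wpM2l.
have /closure2P cuv := adjoint_comp_core lT1 clT1 ov'.
apply: clo; apply/closure2P => e e0.
have d0 : 0 < e / (c + 1) by rewrite divr_gt0 // ltr_wpDl.
have [a [b [[/= Tab [w Abw]] ua vb]]] := cuv _ d0.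
have [z Taz _] := le12 _ _ _ Tab Abw.
have [z' [oz' _ _]] := op_part_ex lT2 clT2 Taz.
have Jb : J b = z'.
  by apply: JN; apply: subset_closure; exists a => //=; split=> //; exists w.
exists a, z'; split=> //.
  by apply: (lt_le_trans ua); rewrite ler_pdivrMr ?ltr_wpDl// mulrDr mulr1 lerDr mulr_ge0 // ltW.
rewrite -Jb -linearB (le_lt_trans (Jc _))//.
apply: (@le_lt_trans _ _ (c * (e / (c + 1)))); first by rewrite ler_wpM2l // ltW.
by rewrite mulrA ltr_pdivrMr ?ltr_wpDl// mulrC ltr_pM2l// ltrDl.
Qed.

(** Since [|v|^2 = <w, u>] for [(u, v)] in [T1] and [(v, w)] in [T1^*], the relation
    [T1^* T1] determines the form of [T1] on a core, hence everywhere. *)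
Lemma form_le_of_comp_sub H K L (T1 : set (H * K)) (T2 : set (H * L)) :
    linear_relation T1 -> closed T1 -> linear_relation T2 -> closed T2 ->
    (adjoint T1 \; T1)%relation `<=` (adjoint T2 \; T2)%relation ->
  forall u v, T1 (u, v) -> exists2 y, op_part T2 (u, y) & hnorm y <= hnorm v.
Proof.
move=> lT1 clT1 lT2 clT2 sub u v Tuv.
have [|y oy yv] := form_le_of_core ler01 lT1 clT1 lT2 clT2 _ Tuv.
  move=> a b c Tab Abc; have [|d /= Tad Adc] := sub (a, c); first by exists b.
  exists d => //; rewrite mul1r ler_hnorm2.
  by rewrite -(adjoint_rdot Adc Tad) (adjoint_rdot Abc Tab).
by exists y => //; rewrite mul1r in yv.
Qed.

(** The square root of [T^* T] and [T] itself have the same form, so in the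
    inequality the former can be replaced by the operator part of [T]. *)
Lemma rel_leP H K (T : set (H * K)) (lam : R) (D : set (H * H)) :
    linear_relation T -> closed T ->
  rel_le (adjoint T \; T)%relation lam D <->
  [/\ selfadjoint D, nonneg_rel D &
    forall x z, sqrt_op D (x, z) ->
      exists2 y, op_part T (x, y) & hnorm y <= Num.sqrt lam * hnorm z].
Proof.
move=> lT clT; set C := (_ \; _)%relation.
have sC : selfadjoint C by exact: selfadjoint_adjoint_comp.
have nC : nonneg_rel C by exact: nonneg_adjoint_comp.
have sqC := sqrt_opP sC nC; set Q := sqrt_op C in sqC *.
have lQ := sqrt_op_linear sC sqC; have clQ := sqrt_op_closed sC sqC.
have QC : (adjoint Q \; Q)%relation = C by exact: sqrt_op_comp.
have QT x y : Q (x, y) -> exists2 z, op_part T (x, z) & hnorm z <= hnorm y.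
  by apply: form_le_of_comp_sub => //; rewrite QC.
have TQ x y : T (x, y) -> exists2 z, Q (x, z) & hnorm z <= hnorm y.
  move=> Txy; have [|z oz zy] := form_le_of_comp_sub lT clT lQ clQ _ Txy; first by rewrite QC.
  by exists z => //; exact: (op_part_sub lQ clQ).
have Qfun x y z : Q (x, y) -> Q (x, z) -> y = z.
  move=> Qy Qz; apply/eqP; rewrite -subr_eq0; apply/eqP.
  apply: (sqrt_op_mul sqC); rewrite -/Q -(subrr x).
  exact: linear_relationB.
split=> [[_ [sD nD] dom le]|[sD nD le]].
  split=> // x z Dxz.
  have [y Qxy] : rel_dom Q x by apply: dom; exists z.
  have [t ot ty] := QT _ _ Qxy; exists t => //.
  by rewrite (le_trans ty)// (le x).
split=> // [x [z Dxz]|x y z Qxy Dxz].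
  have [y oy _] := le _ _ Dxz.
  by have [t Qt _] := TQ _ _ (op_part_sub lT clT oy); exists t.
have [t ot tz] := le _ _ Dxz.
have [s Qs st] := TQ _ _ (op_part_sub lT clT ot).
by rewrite (Qfun _ _ _ Qxy Qs) (le_trans st).
Qed.

Lemma rel_le_of_core H K (T : set (H * K)) (lam : R) (D : set (H * H)) :
    linear_relation T -> closed T -> selfadjoint D -> nonneg_rel D -> 0 <= lam ->
    (forall x z, D (x, z) -> exists2 y, T (x, y) & rdot y y <= lam * rdot z x) ->
  rel_le (adjoint T \; T)%relation lam D.
Proof.
move=> lT clT sD nD lam0 le; apply/rel_leP => //; split=> //.
have sqD := sqrt_opP sD nD.
apply: (form_le_of_core (sqrtr_ge0 lam) (sqrt_op_linear sD sqD)
  (sqrt_op_closed sD sqD) lT clT) => u v w Quv Avw.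
have /le[y Tuy yle] : D (u, w) by rewrite -(sqrt_op_comp sD sqD); exists v.
exists y => //; rewrite ler_hnormP ?mulr_ge0 ?sqrtr_ge0 ?hnorm_ge0//.
by rewrite exprMn sqr_sqrtr // -rdotxx -(adjoint_rdot Avw Quv).
Qed.

End Forms.

(** * Bounded nonnegative operators *)

Section BoundedNonneg.
Variables (R : realType) (K : hilbertType R).
Implicit Types X : {linear K -> K}.

Lemma op_graphE X x y : op_graph X (x, y) = (y = X x).
Proof. by []. Qed.

Lemma BplusI X (c : R) : (forall y, hnorm (X y) <= c * hnorm y) ->
    (forall x y, rdot (X x) y = rdot x (X y)) -> (forall y, 0 <= rdot (X y) y) ->
  Bplus X.
Proof.
move=> Xc Xsym X0; have lX := linear_op_graph X.
have XX : op_graph X `<=` adjoint (op_graph X).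
  move=> [x y]; rewrite op_graphE => ->; apply/adjointP => // u v.
  by rewrite op_graphE => ->; rewrite Xsym.
split; first by exists c.
- apply/seteqP; split=> // -[k h] Xkh; apply: rdot_inj => x /=.
  by rewrite (adjoint_rdot Xkh (erefl : op_graph X (x, X x))) Xsym.
- by apply: nonneg_relI => // x y; rewrite op_graphE => ->.
Qed.

Lemma BplusP X : Bplus X ->
  [/\ forall x y, rdot (X x) y = rdot x (X y), forall y, 0 <= rdot (X y) y
    & exists2 c, 0 < c & forall y, hnorm (X y) <= c * hnorm y].
Proof.
move=> [[c Xc] sX nX]; split=> [x y|y|].
- by have := selfadjoint_rdot sX (erefl : op_graph X (x, X x))
    (erefl : op_graph X (y, X y)).
- exact: nonneg_rdot nX (erefl : op_graph X (y, X y)).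
- exists (`|c| + 1); first by rewrite ltr_wpDl.
  move=> y; rewrite (le_trans (Xc y))// ler_wpM2r ?hnorm_ge0//.
  by rewrite (le_trans (ler_norm c))// lerDl.
Qed.

(** Nonnegativity of [X] at [c y - X y], together with
    [<X X y, X y> <= c |X y|^2]. *)
Lemma nonneg_op_bound X (c : R) y : 0 < c ->
    (forall y, hnorm (X y) <= c * hnorm y) ->
    (forall x y, rdot (X x) y = rdot x (X y)) -> (forall y, 0 <= rdot (X y) y) ->
  rdot (X y) (X y) <= c * rdot (X y) y.
Proof.
move=> c0 Xc Xsym X0.
have h1 := X0 (c%:C%C *: y - X y).
have h2 : rdot (X (X y)) (X y) <= c * rdot (X y) (X y).
  rewrite (le_trans (cauchy_schwarz _ _))// [in leRHS]rdotxx expr2 mulrA.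
  by rewrite ler_wpM2r ?hnorm_ge0.
move: h1; rewrite linearB linearZ /= !rdotE (Xsym (X y) y) => h1.
rewrite -(ler_pM2l c0); lra.
Qed.

Lemma opnorm_le X (c : R) : 0 <= c ->
  (forall y, hnorm (X y) <= c * hnorm y) -> opnorm X <= c.
Proof.
move=> c0 Xc; apply: ge_sup.
  by exists (hnorm (X 0)), 0 => //=; rewrite hnorm0.
move=> _ [y /= y1 <-]; rewrite (le_trans (Xc y))//.
by rewrite -[leRHS]mulr1 ler_wpM2l.
Qed.

End BoundedNonneg.

(** * The factorization *)

Section Factorization.
Variables (R : realType) (H K : hilbertType R) (T B : set (H * K)).
Hypotheses (lT : linear_relation T) (clT : closed T).
Hypothesis lB : linear_relation B.
Hypothesis mulB : rel_mul B `<=` rel_ker (adjoint (op_part T)).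

Let A := (adjoint T \; B)%relation.
Let B0 := rel_restr B (rel_dom A).
Let cB0 := closure B0.
Hypothesis sA : selfadjoint A.

Let lTs : linear_relation (op_part T). Proof. exact: op_part_linear. Qed.
Let clTs : closed (op_part T). Proof. exact: op_part_closed. Qed.

Lemma ker_adjoint_op_part k : rel_ker (adjoint (op_part T)) k <->
  forall x y, op_part T (x, y) -> rdot k y = 0.
Proof.
split=> [Tk x y Txy|h]; first by rewrite -(adjoint_rdot Tk Txy) rdot0l.
by apply/adjointP => // x y /h ->; rewrite rdot0l.
Qed.

Lemma linear_restr_dom_comp : linear_relation B0.
Proof.
have lD := linear_rel_dom (selfadjoint_linear sA).
apply: linear_relationI.
  by split; [exact: linear_relation0|split=> //; exact: linear_subset0 lD].
move=> c x y u v [Bx [/= Dx _]] [Bu [/= Du _]].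
split; first exact: linear_relationP.
by split=> //; exact: linear_subsetP lD Dx Du.
Qed.

Let lcB0 : linear_relation cB0. Proof. exact: linear_closure linear_restr_dom_comp. Qed.

Lemma adjoint_comp_restr : (adjoint T \; B0)%relation = A.
Proof.
apply/seteqP; split=> [[x z] [y /= [Bxy _] Ayz]|[x z] Axz]; first by exists y.
have [y /= Bxy Ayz] := Axz; exists y => //=; split=> //; split=> //.
by exists z.
Qed.

(** The second component [y] is determined by [x] up to [mul B], which pairs to
    zero with the range of [T_s]; so it pairs with this range as the element of
    [dom T^*] that puts [x] in [dom A]. *)
Lemma restr_pairing x y : B0 (x, y) -> exists2 z, A (x, z) &
  forall u v, op_part T (u, v) -> rdot y v = rdot z u.
Proof.
move=> [Bxy [[z Axz] _]]; exists z => // u v Tuv.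
have [y' /= Bxy' Ay'z] := Axz.
have /mulB/ker_adjoint_op_part/(_ _ _ Tuv) : rel_mul B (y - y').
  by rewrite /rel_mul /= -(subrr x); exact: linear_relationB.
rewrite rdotBl (adjoint_rdot Ay'z (op_part_sub lT clT Tuv)).
by move/eqP; rewrite subr_eq0 => /eqP.
Qed.

(** The operator is [X = J J^*], where [J] extends [Q x |-> T_s x] for the square
    root [Q] of [A]. *)
Lemma solution_of_form_le (lam : R) : 0 <= lam ->
    rel_le (adjoint T \; T)%relation lam A ->
  exists X : {linear K -> K},
    [/\ Bplus X, (op_graph X \; cB0)%relation `<=` op_part T,
        rel_ker (adjoint (op_part T)) `<=` rel_ker (op_graph X)
      & opnorm X <= lam].
Proof.
move=> lam0 /(rel_leP _ _ lT clT)[_ nA le]; have sqA := sqrt_opP sA nA.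
set Q := sqrt_op A in le sqA; set s := Num.sqrt lam in le.
have lQ := sqrt_op_linear sA sqA; have QQ := sqrt_op_comp sA sqA.
pose N := [set p : H * K | exists2 x, Q (x, p.1) & op_part T (x, p.2)].
have lN : linear_relation N.
  apply: linear_relationI => [|c x y u v [a /= Qa Ta] [b /= Qb Tb]].
    by exists 0; exact: linear_relation0.
  by exists (c *: a + b); exact: linear_relationP.
have s0 : 0 <= s by exact: sqrtr_ge0.
have Ns h k : N (h, k) -> hnorm k <= s * hnorm h.
  by move=> [x /= Qxh Txk]; have [y /(op_part_fun lT clT Txk) <-] := le _ _ Qxh.
have [J [JcN Js J0 _]] := bounded_extension lN s0 Ns.
have JN h k : N (h, k) -> J h = k by move=> ?; apply: JcN; exact: subset_closure.
have [G [_ JG Gs]] := bounded_adjoint s0 Js.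
have [X XE] : exists X : {linear K -> K}, forall y, X y = J (G y).
  by apply: linear_fun_ex => c x y; rewrite !linearP.
have ss : s * s = lam by rewrite -expr2 sqr_sqrtr.
have Xlam y : hnorm (X y) <= lam * hnorm y.
  by rewrite XE (le_trans (Js _))// -ss -mulrA ler_wpM2l.
(* [J] only sees the part of [G y] in the closure of [ran Q]. *)
have Gorth y q : (forall x h k, Q (x, h) -> op_part T (x, k) -> rdot y k = rdot q h) ->
    J (G y) = J q.
  move=> yq; apply/eqP; rewrite -subr_eq0 -linearB; apply/eqP/J0.
  apply/orthocompP; first exact: linear_rel_dom.
  move=> h [k Nhk]; have [x /= Qxh Txk] := Nhk.
  by rewrite rdotBl (rdotC (G y)) -JG (JN _ _ Nhk) (rdotC k) (yq _ _ _ Qxh Txk) subrr.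
have XB0 x y : B0 (x, y) -> op_part T (x, X y).
  move=> Bxy; have [z Axz yz] := restr_pairing Bxy.
  move: (Axz); rewrite -QQ => -[q /= Qxq Aqz].
  have [t Txt _] := le _ _ Qxq.
  rewrite XE (Gorth y q); last first.
    by move=> u h k Quh Tuk; rewrite (yz _ _ Tuk) (adjoint_rdot Aqz Quh).
  by rewrite (JN q t) //; exists x.
exists X; split; last exact: opnorm_le.
- apply: (BplusI Xlam) => [x y|y]; rewrite !XE.
    by rewrite JG rdotC -JG rdotC.
  by rewrite JG rdotxx_ge0.
- move=> [x t] [y /= cxy]; rewrite op_graphE => ->; apply: clTs; apply/closure2P => e e0.
  have d0 : 0 < e / (lam + 1) by rewrite divr_gt0 // ltr_wpDl.
  move: cxy => /closure2P/(_ _ d0)[u [v [Buv xu yv]]].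
  have lam1 : 0 < lam + 1 by rewrite ltr_wpDl.
  exists u, (X v); split; first exact: XB0.
    apply: (lt_le_trans xu); rewrite ler_pdivrMr // mulrDr mulr1 lerDr.
    by rewrite mulr_ge0 // ltW.
  rewrite -linearB (le_lt_trans (Xlam _))//.
  apply: (@le_lt_trans _ _ (lam * (e / (lam + 1)))); first by rewrite ler_wpM2l // ltW.
  by rewrite mulrA ltr_pdivrMr // mulrC ltr_pM2l// ltrDl.
- move=> k /ker_adjoint_op_part Tk; suff : 0 = X k by [].
  rewrite XE (Gorth k 0) ?linear0//.
  by move=> x h l _ /Tk ->; rewrite rdot0l.
Qed.

Section Solution.
Variable X : {linear K -> K}.
Hypotheses (BX : Bplus X) (XT : (op_graph X \; cB0)%relation `<=` T).

Let XcB0 x y : cB0 (x, y) -> T (x, X y).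
Proof. by move=> Bxy; apply: XT; exists y. Qed.

Lemma form_le_of_solution :
  exists2 lam, 0 <= lam & rel_le (adjoint T \; T)%relation lam A.
Proof.
have [Xsym X0 [c c0 Xc]] := BplusP BX.
have pairing x z : A (x, z) -> exists2 y, T (x, X y) & rdot z x = rdot (X y) y.
  rewrite -adjoint_comp_restr => -[y /= Bxy Ayz]; have Tx := XcB0 (subset_closure Bxy).
  by exists y => //; rewrite (adjoint_rdot Ayz Tx) rdotC.
exists c; first exact: ltW.
have nA : nonneg_rel A.
  apply: nonneg_relI; first by rewrite -sA.
  by move=> x z /pairing[y _ ->].
apply: (rel_le_of_core lT clT sA nA (ltW c0)) => x z /pairing[y Txy ->]; exists (X y) => //; exact: nonneg_op_bound.
Qed.

(** For [(x, y)] and [(u, v)] in the closure of [B0] and [(y, z)] in [T^*],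
    [<z, u> = <y, X v> = <X y, v>], so [(X y, z)] is in [B0^*]. *)
Lemma solution_comp_sub :
  (adjoint T \; cB0)%relation `<=` (adjoint B0 \; (op_graph X \; cB0))%relation.
Proof.
have [Xsym _ _] := BplusP BX.
move=> [x z] [y /= Bxy Ayz]; exists (X y); first by exists y.
rewrite /= -(adjoint_closure linear_restr_dom_comp); apply/adjointP => // u v Buv.
by rewrite (adjoint_rdot Ayz (XcB0 Buv)) Xsym.
Qed.

Lemma adjoint_restr_comp_sub : (adjoint B0 \; T)%relation `<=` A.
Proof.
move=> [x z] [y /= Txy Ayz]; rewrite sA; apply/adjointP.
  exact: selfadjoint_linear.
move=> u w; rewrite -adjoint_comp_restr => -[v /= Buv Avw].
by rewrite (adjoint_rdot Ayz Buv) (rdotC x) (adjoint_rdot Avw Txy) rdotC.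
Qed.

Lemma comp_sub_closure_restr : A `<=` (adjoint T \; cB0)%relation.
Proof.
rewrite -adjoint_comp_restr => -[x z] [y /= Bxy Ayz]; exists y => //.
exact: subset_closure.
Qed.

Lemma solution_comp_eq :
  [/\ (adjoint T \; cB0)%relation = A,
    (adjoint T \; cB0)%relation = (adjoint B0 \; (op_graph X \; cB0))%relation
    & (adjoint B0 \; (op_graph X \; cB0))%relation = (adjoint B0 \; T)%relation].
Proof.
have s1 := solution_comp_sub; have s3 := adjoint_restr_comp_sub; have s4 := comp_sub_closure_restr.
have s2 : (adjoint B0 \; (op_graph X \; cB0))%relation `<=` (adjoint B0 \; T)%relation.
  by move=> [x z] [y /= Xxy Ayz]; exists y => //; exact: XT.
split; apply/seteqP; split=> //.
- by move=> p /s1/s2/s3.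
- by move=> p /s2/s3/s4.
- by move=> p /s3/s4/s1.
Qed.

End Solution.
End Factorization.

(** * The operator part as a direct summand *)

Section DirectSum.
Variables (R : realType) (H K : hilbertType R) (T : set (H * K)).
Hypotheses (lT : linear_relation T) (clT : closed T).

Lemma op_part_direct_sum : direct_sum T (op_part T) (mul_part T).
Proof.
split; apply/seteqP; split.
- move=> [x y] Txy; have [z [oz yz _]] := op_part_ex lT clT Txy.
  exists (x, z) => //; exists (0, y - z) => //.
  by congr pair; rewrite /= ?addr0 // addrC subrK.
- move=> _ [[x y] oxy [[u v] [/= -> Tv] <-]].
  exact: linear_relationD lT (op_part_sub lT clT oxy) Tv.
- move=> [x y] [oxy [/= x0 Ty]]; move: oxy; rewrite x0 => /op_partP[//|//|_ My].
  by have /rdotxx_eq0 -> : rdot y y <= 0 by rewrite (orthocomp_rdot My Ty).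
- move=> _ ->; split; first exact: linear_relation0 (op_part_linear lT clT).
  by split=> //; exact: linear_relation0.
Qed.

End DirectSum.

Local Open Scope relation_scope.

Theorem theorem3p1 (R : realType) (H K : hilbertType R) (T B : set (H * K))
    (linT : linear_relation T) (closedT : closed T)
    (linB : linear_relation B) (closedB : closed B)
    (mulB : rel_mul B `<=` rel_ker (adjoint (op_part T)))
    (saTB : selfadjoint (adjoint T \; B)) :
  let B0 := rel_restr B (rel_dom (adjoint T \; B)) in
  let cB0 := closure B0 in
  let i := fun lam : R => 0 <= lam /\
    rel_le (adjoint T \; T) lam (adjoint T \; B) in
  let ii := fun X : {linear K -> K} =>
    Bplus X /\ (op_graph X \; cB0) `<=` T in
  let iii := (exists lam : R, 0 <= lam /\
      rel_le (adjoint T \; T) lam (adjoint T \; cB0)) /\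
    rel_dom T `<=` rel_dom cB0 in
  let iv := fun X : {linear K -> K} =>
    Bplus X /\ direct_sum T (op_graph X \; cB0) (mul_part T) in
  [/\ (exists lam, i lam) <-> (exists X, ii X),
      forall lam, i lam ->
        exists X : {linear K -> K},
          [/\ ii X, (op_graph X \; cB0) `<=` op_part T,
              rel_ker (adjoint (op_part T)) `<=` rel_ker (op_graph X)
            & opnorm X <= lam],
      forall X : {linear K -> K}, ii X ->
        adjoint T \; cB0 = adjoint B0 \; (op_graph X \; cB0) /\
        adjoint B0 \; (op_graph X \; cB0) = adjoint B0 \; T,
      iii <-> (exists X, iv X)
    & iii ->
        exists X : {linear K -> K},
          [/\ iv X, op_part T = op_graph X \; cB0
            & rel_ker (op_graph X) = rel_ker (adjoint (op_part T))]].
Proof.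
move=> B0 cB0 i ii iii iv.
have i_sol lam : i lam -> exists X : {linear K -> K},
    [/\ ii X, (op_graph X \; cB0) `<=` op_part T,
        rel_ker (adjoint (op_part T)) `<=` rel_ker (op_graph X)
      & opnorm X <= lam].
  move=> [lam0 le].
  have [X [BX XB kerX Xlam]] := solution_of_form_le linT closedT linB mulB saTB lam0 le.
  exists X; split=> //; split=> //.
  by move=> p /XB; exact: op_part_sub.
have sol_i X : ii X -> exists lam, i lam.
  move=> [BX XT]; have [lam lam0 le] := form_le_of_solution linT closedT saTB BX XT.
  by exists lam.
have iii_sol : iii -> exists X : {linear K -> K},
    [/\ iv X, op_part T = op_graph X \; cB0
      & rel_ker (op_graph X) = rel_ker (adjoint (op_part T))].
  move=> [[lam [lam0 le]] domT].
  have TB : adjoint T \; B = adjoint T \; cB0.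
    have [_ [sC _] _ _] := le.
    exact: selfadjoint_sub_eq saTB sC (@comp_sub_closure_restr _ _ _ T B).
  rewrite -TB in le.
  have [X [[BX XT] XB kerX _]] := i_sol lam (conj lam0 le).
  have TX : op_part T = op_graph X \; cB0.
    apply/seteqP; split=> // -[x t] oxt.
    have [|y cxy] := domT x; first by exists t; exact: op_part_sub oxt.
    exists y => //=; rewrite op_graphE.
    by apply: (op_part_fun linT closedT oxt); apply: XB; exists y.
  exists X; split=> //.
    by split=> //; rewrite -TX; exact: op_part_direct_sum.
  apply/seteqP; split=> // k Xk; have [Xsym _ _] := BplusP BX.
  apply/(ker_adjoint_op_part linT closedT) => x t.
  rewrite TX => -[y _ /=]; rewrite op_graphE => ->.
  have Xk0 : X k = 0 by exact: esym Xk.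
  by rewrite -Xsym Xk0 rdot0l.
split=> //.
- split=> [[lam /i_sol[X [iiX _ _ _]]]|[X /sol_i//]]; by exists X.
- move=> X [BX XT].
  by have [_] := solution_comp_eq linB saTB BX XT.
- split=> [/iii_sol[X [ivX _ _]]|[X [BX [TX _]]]]; first by exists X.
  have XT : op_graph X \; cB0 `<=` T.
    move=> p Xp; rewrite TX; exists p => //; exists 0; last by rewrite addr0.
    by split=> //; exact: linear_relation0.
  split.
    have [lam [lam0 le]] := sol_i X (conj BX XT).
    exists lam; split=> //.
    by have [-> _ _] := solution_comp_eq linB saTB BX XT.
  move=> x [y]; rewrite TX => -[[a b] [c /= cac _] [[u v] [/= -> _] [<- _]]].
  by exists c; rewrite addr0.
Qed.
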